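(* Consider the interacting system described in the context, with $N\ge 1$ and $1/2<\gamma\le 1$, and let $Z_\infty$ be the random variable with values in $[0,1]$ defined as the common almost sure limit of the processes $(Z_{n,j})_n$, $1\le j\le N$. Then $$\mathbf{N}_n \longrightarrow Z_\infty \mathbf{1}\qquad\text{almost surely as } n\to\infty.$$ Moreover: (i) $P(Z_\infty=z)=0$ for every $z\in(0,1)$. (ii) If $P\big(\bigcap_{j=1}^N\{Z_{0,j}=0\}\big)+P\big(\bigcap_{j=1}^N\{Z_{0,j}=1\}\big)<1$, then $P(0<Z_\infty<1)>0$.
   Context: Model. Let $N\ge1$ and let $W=[w_{h,j}]_{1\le h,j\le N}$ be a real matrix with $w_{h,j}\ge 0$ and $\sum_{h=1}^N w_{h,j}=1$ for every $j$ (i.e. $W^\top\mathbf{1}=\mathbf{1}$). It is assumed that $W$ is irreducible and diagonalizable (over $\mathbb{C}$). Let $(r_n)_{n\ge0}$ be real numbers with $0\le r_n<1$ and $\lim_n n^\gamma r_n=c$ for some constants $c>0$ and $1/2<\gamma\le1$. On a probability space let $Z_{0,1},\dots,Z_{0,N}$ be $[0,1]$-valued random variables and let $X_{n,j}$ ($n\ge1$, $1\le j\le N$) be $\{0,1\}$-valued random variables; set $\mathcal{F}_n=\sigma(Z_{0,h}:1\le h\le N)\vee\sigma(X_{k,j}:1\le k\le n,\,1\le j\le N)$. For every $n\ge0$ the variables $X_{n+1,1},\dots,X_{n+1,N}$ are conditionally independent given $\mathcal{F}_n$ with $P(X_{n+1,j}=1\mid\mathcal{F}_n)=\sum_{h=1}^N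 w_{h,j}Z_{n,h}$, where $Z_{n,h}=(1-r_{n-1})Z_{n-1,h}+r_{n-1}X_{n,h}$ for $n\ge1$. Empirical means: $N_{0,j}=0$, $N_{n,j}=\frac1n\sum_{k=1}^nX_{k,j}$ for $n\ge1$, and $\mathbf{N}_n=(N_{n,1},\dots,N_{n,N})^\top$. $\mathbf{1}$ is the all-ones vector. Previously known fact giving the definition of $Z_\infty$: under these assumptions all the processes $(Z_{n,j})_n$, $1\le j\le N$, converge almost surely to one and the same $[0,1]$-valued random variable, denoted $Z_\infty$. *)

(* Defs.v *)
From HB Require Import structures.
From mathcomp Require Import all_boot all_order all_algebra.
From mathcomp Require Import complex.
From mathcomp Require Import all_classical all_reals all_analysis.
Set Implicit Arguments.
Unset Strict Implicit.
Unset Printing Implicit Defensive.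
Import Order.TTheory GRing.Theory Num.Theory.
Import numFieldNormedType.Exports.
Local Open Scope classical_set_scope.
Local Open Scope ring_scope.

(* Irreducibility of a nonnegative matrix: the directed graph with an edge
   h -> j whenever W h j > 0 is strongly connected. *)
Definition irreducible_mx (R : realType) (N : nat) (W : 'M[R]_N) : Prop :=
  forall h j : 'I_N, connect (fun a b : 'I_N => 0 < W a b) h j.

Definition diagonalizable_over_C (R : realType) (N : nat) (W : 'M[R]_N) : Prop :=
  diagonalizable (map_mx (real_complex R) W).

(* f is a version of the conditional probability P(A | G); the set system G is
   meant to be a sub-sigma-algebra of the measurable sets. *)
Definition is_cond_prob (d : measure_display) (T : measurableType d)
    (R : realType) (P : probability T R) (G : set (set T)) (A : set T)
    (f : T -> R) : Prop :=
  [/\ forall B : set R, measurable B -> G (f @^-1` B),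
      P.-integrable setT (EFin \o f) &
      forall B : set T, G B ->
        (\int[P]_(w in B) (f w)%:E)%E = P (A `&` B)].

(* Versions are unique up to P-null sets, so requiring the product rule for
   every choice f of versions amounts to its almost sure validity. *)
Definition cond_independent (d : measure_display) (T : measurableType d)
    (R : realType) (P : probability T R) (G : set (set T)) (I : finType)
    (Y : I -> T -> R) : Prop :=
  forall (J : {set I}) (B : I -> set R) (f : I -> T -> R),
    (forall j, j \in J -> measurable (B j)) ->
    (forall j, j \in J -> is_cond_prob P G (Y j @^-1` B j) (f j)) ->
    is_cond_prob P G (\bigcap_(j in [set` J]) (Y j @^-1` B j))
      (fun w => \prod_(j in J) f j w).

(* F_n, generated by Z0 and by X k for 1 <= k <= n; X 0 plays no role. *)
Definition history (d : measure_display) (T : measurableType d)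
    (R : realType) (N : nat) (Z0 : 'I_N -> T -> R) (X : nat -> 'I_N -> T -> R)
    (n : nat) : set (set T) :=
  <<s [set A | exists h, preimage_set_system setT (Z0 h) measurable A] `|`
      [set A | exists k j, (1 <= k <= n)%N /\
                 preimage_set_system setT (X k j) measurable A] >>.

(* At n = 0 this is the zero vector, since 0^-1 = 0 and the sum is empty. *)
Definition empirical_mean (T : Type) (R : realType) (N : nat)
    (X : nat -> 'I_N -> T -> R) (n : nat) (w : T) : 'cV[R]_N :=
  \col_j (n%:R^-1 * \sum_(1 <= k < n.+1) X k j w).

(* Main.v *)
Require Import Defs.
From HB Require Import structures.
From mathcomp Require Import all_boot all_order all_algebra.
From mathcomp Require Import all_classical all_reals all_analysis.
From mathcomp Require Import measurable_realfun.
From mathcomp Require Import ring lra.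
Set Implicit Arguments.
Unset Strict Implicit.
Unset Printing Implicit Defensive.
Import Order.TTheory GRing.Theory Num.Theory.
Import numFieldNormedType.Exports.
Local Open Scope classical_set_scope.
Local Open Scope ring_scope.

(** Write [p_n = W^T Z_n] for the vector of conditional success probabilities.

    The noise [X_(n+1) - p_n] is a bounded martingale difference, whose partial
    sums [S_n] satisfy [E S_n^4 <= 11 n^2]; as [sum 1/n^2] converges, [S_n/n]
    tends to [0] almost surely, and the Cesaro means of [p_n] tend to [Zinf].

    If [v] is the positive Perron vector of [W], then [U_n = v^T Z_n] is a
    martingale converging to [Zinf], whose conditional variance [r_n^2 q_n]
    satisfies [q_n <= U_n (1 - U_n)].  Hence [E (U_n (1 - U_n))] decreases at
    most by the factor [1 - r_n^2], and [sum r_n^2] converges because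
    [gamma > 1/2]; this gives (ii).

    For (i), suppose [P (Zinf = z) > 0].  For large [n] some [F_n]-measurable
    weight [g] is close in L1 to the indicator of [Zinf = z], where
    [Y = Zinf - U_n] equals the [F_n]-measurable variable [z - U_n]; since [Y] is
    conditionally centered, [E (g |Y|)] is much smaller than [R], with
    [R^2 = sum_(k >= n) r_k^2].  But [E (g Y^2)] is at least of order [R^2],
    because [q_k] tends to a positive constant on [Zinf = z], while
    [E (g Y^4)] is at most of order [R^4], which forces [E (g |Y|)] to be of
    order [R]. *)

(** * Bounded measurable functions *)

Section bounded_measurable.
Context (R : realType) (d : measure_display) (T : measurableType d).
Implicit Types f g : T -> R.

(** The class is stable under the algebra used below, and all its members are integrable under a
    probability. Since the sigma-algebra is carried by the type [T], instantiating [T] with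
    [g_sigma_algebraType (G n)] turns [bmeas] into bounded and [G n]-measurable, which is how
    adaptedness is expressed. *)
Definition bmeas f := measurable_fun setT f /\ exists M : R, forall w, `|f w| <= M.

Lemma bmeas_cst c : bmeas (fun=> c).
Proof. by split; [exact: measurable_cst|exists `|c|]. Qed.

Lemma bmeasD f g : bmeas f -> bmeas g -> bmeas (fun w => f w + g w).
Proof.
move=> [mf [M fM]] [mg [M' gM]]; split; first exact: measurable_funD.
by exists (M + M') => w; rewrite (le_trans (ler_normD _ _))// lerD.
Qed.

Lemma bmeasM f g : bmeas f -> bmeas g -> bmeas (fun w => f w * g w).
Proof.
move=> [mf [M fM]] [mg [M' gM]]; split; first exact: measurable_funM.
by exists (M * M') => w; rewrite normrM ler_pM.
Qed.

Lemma bmeasN f : bmeas f -> bmeas (fun w => - f w).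
Proof.
move=> bf; rewrite (_ : (fun w => - f w) = fun w => -1 * f w).
  by apply: bmeasM => //; exact: bmeas_cst.
by apply/funext => w; rewrite mulN1r.
Qed.

Lemma bmeasB f g : bmeas f -> bmeas g -> bmeas (fun w => f w - g w).
Proof. by move=> bf bg; apply: bmeasD => //; exact: bmeasN. Qed.

Lemma bmeasX f n : bmeas f -> bmeas (fun w => f w ^+ n).
Proof.
move=> bf; elim: n => [|n IH].
  rewrite (_ : (fun w => _) = fun=> 1); first exact: bmeas_cst.
  by apply/funext => w; rewrite expr0.
rewrite (_ : (fun w => _) = fun w => f w * f w ^+ n); first exact: bmeasM.
by apply/funext => w; rewrite exprS.
Qed.

Lemma bmeas_sum (I : Type) (s : seq I) (Q : pred I) (F : I -> T -> R) :
  (forall i, bmeas (F i)) -> bmeas (fun w => \sum_(i <- s | Q i) F i w).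
Proof.
move=> bF; elim: s => [|i s IH].
  rewrite (_ : (fun w => _) = fun=> 0); first exact: bmeas_cst.
  by apply/funext => w; rewrite big_nil.
rewrite (_ : (fun w => _) = fun w => (if Q i then F i w else 0) +
    \sum_(j <- s | Q j) F j w).
  by apply: bmeasD => //; case: (Q i) => //; exact: bmeas_cst.
by apply/funext => w; rewrite big_cons; case: ifP; rewrite ?add0r.
Qed.

Lemma bmeas_norm f : bmeas f -> bmeas (fun w => `|f w|).
Proof.
move=> [mf [M fM]]; split; first exact: measurableT_comp.
by exists M => w; rewrite normr_id.
Qed.

Lemma bmeas_indic (A : set T) : measurable A -> bmeas (\1_A : T -> R).
Proof.
move=> mA; split; first exact: measurable_indic.
by exists 1 => w; rewrite indicE; case: (_ \in _); rewrite ?normr1 ?normr0.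
Qed.

End bounded_measurable.

(** Descends through the expression and closes the leaves by [assumption]; this is why facts such as
    [bU n] are put into the context unnamed before a call. *)
Ltac bm := repeat first [assumption | exact: bmeas_cst | apply: bmeasD
  | apply: bmeasN | apply: bmeasM | apply: bmeasX | apply: bmeas_norm
  | by apply: bmeas_indic | (apply: bmeas_sum => ?)].

(** * Expectations of bounded functions *)

Section expectation.
Context (R : realType) (d : measure_display) (T : measurableType d).
Context (P : probability T R).
Implicit Types f g : T -> R.
Local Notation E f := (Rintegral P setT f).

Lemma bmeas_integrable f : bmeas f -> P.-integrable setT (EFin \o f).
Proof.
move=> [mf [M fM]].
apply: (@le_integrable _ _ _ P setT measurableT _ (EFin \o cst `|M|)).
- exact/measurable_EFinP.
- by move=> w _; rewrite /= lee_fin normr_id (le_trans (fM w))// ler_norm.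
- exact: finite_measure_integrable_cst.
Qed.

Lemma ED f g : bmeas f -> bmeas g ->
  E (fun w => f w + g w) = E f + E g.
Proof. by move=> bf bg; rewrite RintegralD//; exact: bmeas_integrable. Qed.

Lemma EB f g : bmeas f -> bmeas g ->
  E (fun w => f w - g w) = E f - E g.
Proof. by move=> bf bg; rewrite RintegralB//; exact: bmeas_integrable. Qed.

Lemma EZ c f : bmeas f -> E (fun w => c * f w) = c * E f.
Proof. by move=> bf; rewrite RintegralZl//; exact: bmeas_integrable. Qed.

Lemma Ecst c : E (fun=> c) = c.
Proof.
rewrite Rintegral_cst//= -[RHS]mulr1; congr (_ * _).
by have -> : P setT = 1%E by exact: probability_setT.
Qed.

Lemma E_sum (I : Type) (s : seq I) (Q : pred I) (F : I -> T -> R) :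
  (forall i, bmeas (F i)) ->
  E (fun w => \sum_(i <- s | Q i) F i w) = \sum_(i <- s | Q i) E (F i).
Proof.
move=> bF; elim: s => [|i s IH].
  rewrite (_ : (fun w => _) = fun=> 0); first by rewrite Ecst big_nil.
  by apply/funext => w; rewrite big_nil.
rewrite big_cons.
case: ifP => Qi; rewrite -IH -?ED//; try exact: bmeas_sum.
  by congr Rintegral; apply/funext => w; rewrite big_cons Qi.
by congr Rintegral; apply/funext => w; rewrite big_cons Qi.
Qed.

Lemma E_le f g : bmeas f -> bmeas g -> (forall w, f w <= g w) -> E f <= E g.
Proof. by move=> bf bg fg; apply: le_Rintegral => //; exact: bmeas_integrable. Qed.

Lemma E_ge0 f : (forall w, 0 <= f w) -> 0 <= E f.
Proof. by move=> f0; exact: Rintegral_ge0. Qed.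

Lemma E_norm f : bmeas f -> `|E f| <= E (fun w => `|f w|).
Proof. by move=> bf; apply: le_normr_Rintegral => //; exact: bmeas_integrable. Qed.

Lemma E_indic (A : set T) : measurable A -> (E (\1_A))%:E = P A.
Proof.
move=> mA; rewrite /Rintegral fineK.
  by rewrite integral_indic// setIT.
by rewrite integral_indic// setIT fin_num_measure.
Qed.

Lemma E_cvg (f : nat -> T -> R) g M : (forall n, measurable_fun setT (f n)) ->
  (forall n w, `|f n w| <= M) -> measurable_fun setT g ->
  {ae P, forall w, f n w @[n --> \oo] --> g w} ->
  E (f n) @[n --> \oo] --> E g.
Proof.
move=> mf fM mg fg.
have [] := @dominated_convergence _ _ _ P setT measurableT
  (fun n => EFin \o f n) (EFin \o g) (EFin \o cst M).
- by move=> n; exact/measurable_EFinP.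
- exact/measurable_EFinP.
- apply: filterS fg => w fg _; apply: cvg_EFin => //; exact: nearW.
- exact: finite_measure_integrable_cst.
- by apply/aeW => w n _; rewrite /= lee_fin.
move=> ig _ cv.
apply: fine_cvg; rewrite fineK//.
exact: integrable_fin_num.
Qed.

Lemma bmeas_neq0 f : bmeas f -> measurable [set w | f w != 0].
Proof.
move=> [mf _]; rewrite (_ : [set w | _] = [set: T] `&` f @^-1` (~` [set 0])).
  by apply: mf => //; exact: measurableC.
by rewrite setTI; apply/seteqP; split => w /=; [move/eqP|move=> ?; apply/eqP].
Qed.

Lemma E_eq0 f : bmeas f -> (forall w, 0 <= f w) -> E f = 0 ->
  P [set w | f w != 0] = 0%E.
Proof.
move=> bf f0 Ef.
have mf : measurable_fun setT (EFin \o f) by apply/measurable_EFinP; case: bf.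
have : (\int[P]_(w in setT) `|(EFin \o f) w| = 0)%E.
  under eq_integral do rewrite gee0_abs ?lee_fin//=.
  rewrite -[LHS]fineK; last by apply: integrable_fin_num => //; exact: bmeas_integrable.
  by congr EFin.
move/(ae_eq_integral_abs _ measurableT mf) => [B [mB PB sB]].
apply: (subset_measure0 _ mB _ PB); first exact: bmeas_neq0.
move=> w /= fw; apply: sB => /= /(_ I) [] f0w.
by rewrite f0w eqxx in fw.
Qed.

End expectation.

(** * Limits of finite sums and powers *)

Section limits.
Context (R : realType).

Lemma cvg_sumr (I : Type) (s : seq I) (F : nat -> I -> R) (l : I -> R) :
  (forall i, F n i @[n --> \oo] --> l i) ->
  \sum_(i <- s) F n i @[n --> \oo] --> \sum_(i <- s) l i.
Proof.
move=> Fl; elim: s => [|i s IH].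
  rewrite big_nil (_ : (fun n => _) = fun=> 0); first exact: cvg_cst.
  by apply/funext => n; rewrite big_nil.
rewrite big_cons (_ : (fun n => _) = fun n => F n i + \sum_(i <- s) F n i).
  exact: cvgD.
by apply/funext => n; rewrite big_cons.
Qed.

Lemma cvg_exprn (f : nat -> R) (l : R) k :
  f n @[n --> \oo] --> l -> f n ^+ k @[n --> \oo] --> l ^+ k.
Proof. exact: continuous_cvg (@exprn_continuous _ k l). Qed.

End limits.

(** * The positive Perron vector *)

Section perron.
Context (R : realType) (N : nat).

(** Unit column sums make 1 an eigenvalue of [W], with a real right eigenvector [u]. The entrywise
    absolute value of [u] is again an eigenvector, irreducibility makes it positive everywhere, and
    it is then normalized. *)
Lemma perron_vector (W : 'M[R]_N) : (1 <= N)%N ->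
  (forall h j, 0 <= W h j) -> (forall j, \sum_(h < N) W h j = 1) ->
  irreducible_mx W ->
  exists v : 'I_N -> R, [/\ forall j, 0 < v j, \sum_(j < N) v j = 1 &
    forall h, \sum_(j < N) W h j * v j = v h].
Proof.
move=> N1 W0 W1 Wirr.
have [u u0 uW] : exists2 u : 'rV[R]_N, u != 0 & forall h, \sum_(j < N) W h j * u 0 j = u 0 h.
  (* The all-ones row lies in the left kernel of [W - 1]; invariance of the determinant under
     transposition then yields a right eigenvector. *)
  have : \det (W - 1%:M) == 0.
    apply/det0P; exists (const_mx 1).
      apply/eqP => /matrixP /(_ 0 (Ordinal N1)); rewrite !mxE => /eqP.
      by rewrite oner_eq0.
    rewrite mulmxBr mulmx1; apply/matrixP => i j; rewrite !mxE.
    under eq_bigr do rewrite mxE mul1r.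
    by rewrite W1 subrr.
  rewrite -det_tr => /det0P[u u0]; rewrite linearB/= trmx1 mulmxBr mulmx1.
  move/eqP; rewrite subr_eq0 => /eqP uW; exists u => // h.
  rewrite -[in RHS]uW mxE; apply: eq_bigr => j _.
  by rewrite mxE mulrC.
pose w j := `|u 0 j|.
have w0 j : 0 <= w j by exact: normr_ge0.
(* |u| <= W |u| entrywise, and both sides have the same sum. *)
have wW h : \sum_(j < N) W h j * w j = w h.
  have le h' : w h' <= \sum_(j < N) W h' j * w j.
    rewrite /w -[in leLHS]uW (le_trans (ler_norm_sum _ _ _))// ler_sum// => j _.
    by rewrite normrM (ger0_norm (W0 _ _)).
  apply/eqP; rewrite -subr_eq0.
  have : \sum_h (\sum_(j < N) W h j * w j - w h) == 0.
    rewrite sumrB exchange_big/= subr_eq0; apply/eqP/eq_bigr => j _.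
    by rewrite -mulr_suml W1 mul1r.
  rewrite psumr_eq0 => [/allP/(_ h)|i _]; last by rewrite subr_ge0.
  by rewrite mem_index_enum; apply.
have [j0 wj0] : exists j, 0 < w j.
  have [[j uj]|all0] := pselect (exists j, u 0 j != 0).
    by exists j; rewrite normr_gt0.
  case/eqP: u0; apply/matrixP => i j; rewrite ord1 mxE.
  by apply/eqP; apply/negPn/negP => uj; apply: all0; exists j.
(* Positivity travels backwards along a path from [h] to [j0]: an edge from [h] to [k] gives
   [w h >= W h k * w k]. *)
have wpos h : 0 < w h.
  have /connectP[p] := Wirr h j0.
  elim: p h => [|k p IH] h /=; first by move=> _ <-.
  move=> /andP[Whk pp] jE; rewrite -wW (bigD1 k)//=.
  apply: ltr_pwDl; first by rewrite mulr_gt0// IH.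
  by apply: sumr_ge0 => i _; rewrite mulr_ge0.
have S0 : 0 < \sum_j w j.
  rewrite (bigD1 j0)//=; apply: ltr_pwDl => //.
  by apply: sumr_ge0 => i _.
exists (fun j => w j / \sum_j w j); split.
- by move=> j; rewrite divr_gt0.
- by rewrite -mulr_suml divff// gt_eqF.
- move=> h; rewrite -[in RHS]wW mulr_suml; apply: eq_bigr => j _.
  by rewrite mulrA.
Qed.

End perron.

(** * Summability of the squared step sizes *)

Section series.
Context (R : realType).

(** A telescoping form of the integral test. Dividing by the power of [n+1] reduces it to
    [(1 - 1/(n+1))^(-s) >= 1 + s/(n+1)], which follows from [exp x >= 1 + x] and
    [ln (1 + x) <= x]. *)
Lemma powR_telescope (n : nat) (s : R) : 0 < s -> (0 < n)%N ->
  s * (n.+1%:R `^ (s + 1))^-1 <= n%:R `^ (- s) - n.+1%:R `^ (- s).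
Proof.
move=> s0 n0.
have np : 0 < n%:R :> R by rewrite ltr0n.
have n1p : 0 < n.+1%:R :> R by rewrite ltr0n.
rewrite powRD; last by rewrite (gt_eqF n1p) implybT.
rewrite powRr1 ?ler0n// invfM -(powRN _ s).
set f := n.+1%:R `^ (- s).
have f0 : 0 < f by exact: powR_gt0.
have key : n%:R `^ (- s) >= f * (1 + s * n.+1%:R^-1).
  have -> : n%:R = n.+1%:R * (1 - n.+1%:R^-1) :> R.
    by rewrite mulrBr mulr1 divff ?gt_eqF// -natr1 addrK.
  have t0 : 0 < 1 - n.+1%:R^-1 :> R.
    by rewrite subr_gt0 invf_lt1// ltr1n.
  rewrite powRM ?(ltW n1p) ?(ltW t0)// ler_wpM2l ?(ltW f0)//.
  rewrite /powR (gt_eqF t0).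
  apply: le_trans (expR_ge1Dx _).
  rewrite lerD2l mulNr -mulrN ler_wpM2l ?(ltW s0)//.
  rewrite lerNr (le_trans (le_ln1Dx _))//.
  by rewrite ltrN2 invf_lt1// ltr1n.
apply: le_trans (lerB key (lexx _)).
rewrite mulrDr mulr1 addrC addKr.
by rewrite mulrCA.
Qed.

(** The limit bounds [u n ^+ 2] by a multiple of [n^(-2 gamma)] from some index on, and the exponent
    exceeds 1, so the nondecreasing partial sums are bounded. *)
Lemma cvg_series_sqr (u : nat -> R) (c gamma : R) : 2^-1 < gamma ->
  ((n%:R `^ gamma) * u n) @[n --> \oo] --> c ->
  cvgn (series (fun n => u n ^+ 2)).
Proof.
move=> g2 ucvg.
apply: nondecreasing_is_cvgn.
  apply/nondecreasing_seqP => n.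
  by rewrite /series/= big_nat_recr//= lerDl sqr_ge0.
(* Chosen so that [s + 1] is twice [gamma], the exponent telescoped by [powR_telescope]. *)
pose s : R := gamma + gamma - 1.
have s0 : 0 < s by rewrite /s; lra.
have [M Mpos uM] : exists2 M : R, 0 < M & \forall n \near \oo, `|n%:R `^ gamma * u n| <= M.
  exists (`|c| + 1); first by rewrite ltr_wpDl.
  move: ucvg => /cvgrPdist_le /(_ 1 ltr01); apply: filterS => n h.
  rewrite -lerBlDl (le_trans _ h)// (le_trans _ (ler_dist_dist _ _))// distrC.
  exact: ler_norm.
case: uM => n0 _ uM.
pose C : R := M ^+ 2 / s.
have C0 : 0 <= C by rewrite divr_ge0// ?sqr_ge0// ltW.
have step n : (n0 < n)%N -> u n.+1 ^+ 2 <= C * (n%:R `^ (- s) - n.+1%:R `^ (- s)).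
  move=> n0n; have n1p : 0 < n.+1%:R :> R by rewrite ltr0n.
  have p0 : 0 < n.+1%:R `^ gamma :> R by exact: powR_gt0.
  apply: (@le_trans _ _ (C * (s * (n.+1%:R `^ (s + 1))^-1))); last first.
    by rewrite ler_wpM2l// powR_telescope// (leq_trans _ n0n).
  rewrite /C mulrA divfK ?gt_eqF// /s subrK powRD; last first.
    by rewrite (gt_eqF n1p) implybT.
  rewrite -expr2 -expr_div_n -[leLHS]real_normK ?num_real//.
  rewrite lerXn2r ?nnegrE ?divr_ge0 ?(ltW Mpos) ?(ltW p0)//.
  rewrite ler_pdivlMr// mulrC -[X in X * _]gtr0_norm// -normrM.
  by apply: uM => /=; rewrite ltnW// ltnW.
(* The bound is the head of the series plus the whole telescoping sum from [n0.+1] on. *)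
exists (series (fun n => u n ^+ 2) n0.+2 + C * n0.+1%:R `^ (- s)) => _ [n _ <-].
have [nn0|nn0] := leqP n n0.+2.
  apply: (@le_trans _ _ (series (fun n => u n ^+ 2) n0.+2)).
    by rewrite /series/= (@big_cat_nat _ _ _ n 0 n0.+2)//= lerDl sumr_ge0// => i _; exact: sqr_ge0.
  by rewrite lerDl mulr_ge0// powR_ge0.
rewrite /series/= (@big_cat_nat _ _ _ n0.+2 0 n) ?(ltnW nn0)//= lerD2l.
case: n nn0 => // n nn0.
rewrite big_add1/=.
apply: (@le_trans _ _ (\sum_(n0.+1 <= k < n) C * (k%:R `^ (- s) - k.+1%:R `^ (- s)))).
  rewrite big_nat [leRHS]big_nat; apply: ler_sum => k /andP[k1 _].
  exact: step.
rewrite -mulr_sumr ler_wpM2l//.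
have -> : \sum_(n0.+1 <= k < n) (k%:R `^ (- s) - k.+1%:R `^ (- s)) =
    - \sum_(n0.+1 <= k < n) (k.+1%:R `^ (- s) - k%:R `^ (- s)) :> R.
  by rewrite -sumrN; apply: eq_bigr => i _; rewrite [RHS]opprB.
rewrite (telescope_sumr (fun k => k%:R `^ (- s))); last by rewrite ltnS in nn0; exact: ltnW.
by rewrite opprB gerBl powR_ge0.
Qed.

End series.

(** * Orthogonality to a sub-sigma-algebra *)

Section sub_sigma_algebra.
Context (R : realType) (d : measure_display) (T : measurableType d).
Context (P : probability T R) (G : set (set T)).
Hypothesis mG : G `<=` measurable.
Local Notation E f := (Rintegral P setT f).
Local Notation bmeasG := (@bmeas R _ (g_sigma_algebraType G)).

Lemma sub_sigma_measurable (A : set T) : <<s G >> A -> measurable A.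
Proof. by apply: smallest_sub => //; exact: sigma_algebra_measurable. Qed.

Lemma bmeas_sub (f : T -> R) : bmeasG f -> bmeas f.
Proof.
move=> [mf bf]; split => // _ Y mY; apply: sub_sigma_measurable.
exact: mf.
Qed.

(* Subtracting M/2 times the sign of g halves the sup norm of g without
   changing its integral against k; iterating makes that integral vanish. *)
Lemma E_orthogonal (k : T -> R) : bmeas k ->
  (forall B, <<s G >> B -> E (fun w => \1_B w * k w) = 0) ->
  forall g : T -> R, bmeasG g -> E (fun w => g w * k w) = 0.
Proof.
move=> bk k0 g bg.
have halve n : forall (M : R) (g : T -> R), bmeasG g -> (forall w, `|g w| <= M) ->
    `|E (fun w => g w * k w)| <= 2^-1 ^+ n * (M * E (fun w => `|k w|)).
  elim: n => [|n IH] M h bh hM.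
    have bh' := bmeas_sub bh.
    rewrite expr0 mul1r (le_trans (E_norm _ _)); [by []|by bm|].
    rewrite -EZ; last by bm.
    apply: E_le; [by bm|by bm|] => w.
    by rewrite normrM ler_wpM2r.
  pose B : set T := [set w | 0 <= h w].
  have GB : <<s G >> B.
    rewrite (_ : B = [set: T] `&` h @^-1` `[0, +oo[).
      by case: bh => mh _; apply: mh => //; exact: measurable_itv.
    by rewrite setTI; apply/seteqP; split => w /=; rewrite in_itv/= andbT.
  have mB := sub_sigma_measurable GB.
  pose h1 w := h w - (M * \1_B w - M / 2).
  have bB : bmeasG (\1_B : T -> R) by apply: (@bmeas_indic R _ (g_sigma_algebraType G)).
  have bh1 : bmeasG h1 by rewrite /h1; bm.
  have h1M w : `|h1 w| <= M / 2.
    rewrite /h1 indicE; have := hM w; rewrite ler_norml => /andP[hw1 hw2].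
    rewrite ler_norml; case: (boolP (w \in B)) => [/set_mem|/negP]/=.
      by rewrite /B/= => h0; apply/andP; split; lra.
    rewrite inE /B/= => /negP; rewrite -ltNge => h0.
    by apply/andP; split; lra.
  have -> : E (fun w => h w * k w) = E (fun w => h1 w * k w).
    have bBT := bmeas_sub bB; have bh1T := bmeas_sub bh1.
    (* The constant is written with [\1_setT] so that [k0] applies to it as well as to [\1_B]. *)
    rewrite (_ : (fun w => h w * k w) = (fun w => h1 w * k w +
      (M * (\1_B w * k w) - (M / 2) * (\1_setT w * k w)))); last first.
      apply/funext => w; rewrite /h1.
      have -> : \1_[set: T] w = 1 :> R by rewrite indicT.
      by ring.
    have bTT : bmeas (\1_[set: T] : T -> R) by exact: bmeas_indic.
    rewrite ED; [|by bm|by bm].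
    rewrite EB; [|by bm|by bm].
    rewrite !EZ; [|by bm|by bm].
    rewrite k0// k0; last first.
      exact: (@measurableT _ (g_sigma_algebraType G)).
    by rewrite !mulr0 subrr addr0.
  apply: le_trans (IH _ _ bh1 h1M) _.
  rewrite exprSr; set e := E _; lra.
case: (bg) => _ [M gM].
apply/eqP; rewrite -normr_le0.
set C := M * E (fun w => `|k w|).
have cv : (fun n => 2^-1 ^+ n * C) @ \oo --> 0 * C.
  apply: cvgM; last exact: cvg_cst.
  by apply: cvg_expr; rewrite gtr0_norm// invf_lt1// ltr1n.
rewrite mul0r in cv; apply: (cvgr_to_ge cv).
by apply: nearW => n; exact: halve.
Qed.

End sub_sigma_algebra.

(** * Almost sure convergence from summable expectations *)

Section summable_expectations.
Context (R : realType) (d : measure_display) (T : measurableType d).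
Context (P : probability T R).
Local Notation E f := (Rintegral P setT f).

(** By monotone convergence the sum of the [f n] has finite expectation, hence is finite almost
    everywhere, and the terms of a convergent series tend to 0. *)
Lemma ae_cvg0_summable (f : nat -> T -> R) (u : nat -> R) :
  (forall n, bmeas (f n)) -> (forall n w, 0 <= f n w) ->
  (forall n, E (f n) <= u n) -> cvgn (series u) ->
  {ae P, forall w, f n w @[n --> \oo] --> 0}.
Proof.
move=> bf f0 fu cu.
have u0 n : 0 <= u n by rewrite (le_trans _ (fu n))// E_ge0.
have mf n : measurable_fun setT (EFin \o f n) by apply/measurable_EFinP; case: (bf n).
have f0' n w : (0 <= (f n w)%:E)%E by rewrite lee_fin.
pose F w := (\sum_(n <oo) (f n w)%:E)%E.
have F0 w : (0 <= F w)%E by apply: nneseries_ge0.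
have IF : P.-integrable setT F.
  apply/integrableP; split.
    by apply: ge0_emeasurable_sum => [k w _ _|k _]; [exact: f0'|exact: mf].
  under eq_integral do rewrite gee0_abs//.
  rewrite integral_nneseries//.
  have iE n : (\int[P]_w (f n w)%:E)%E = (E (f n))%:E.
    by rewrite /Rintegral fineK//; apply: integrable_fin_num => //; exact: bmeas_integrable.
  under eq_eseriesr do rewrite iE.
  apply: (@le_lt_trans _ _ (limn (series u))%:E); last exact: ltry.
  apply: lime_le.
    by apply: is_cvg_nneseries => n _ _; rewrite lee_fin E_ge0.
  apply: nearW => n; rewrite sumEFin lee_fin.
  apply: (@le_trans _ _ (series u n)); first exact: ler_sum.
  apply: nondecreasing_cvgn_le => //.
  by apply/nondecreasing_seqP => k; rewrite /series/= big_nat_recr//= lerDl.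
have := integrable_ae measurableT IF; apply: filterS => w /(_ I) Fw.
apply: cvg_series_cvg_0.
apply: nondecreasing_is_cvgn.
  by apply/nondecreasing_seqP => k; rewrite /series/= big_nat_recr//= lerDl.
exists (fine (F w)) => _ [n _ <-].
rewrite -lee_fin fineK// /series/= -sumEFin.
exact: nneseries_lim_ge.
Qed.

End summable_expectations.

(** * Moments of martingales with bounded differences, and a law of large numbers *)

Section martingale_differences.
Context (R : realType) (d : measure_display) (T : measurableType d).
Context (P : probability T R) (G : nat -> set (set T)).
Hypothesis mG : forall n, G n `<=` measurable.
Hypothesis incrG : forall n, G n `<=` G n.+1.
Local Notation E f := (Rintegral P setT f).
Local Notation bmeasG n := (@bmeas R _ (g_sigma_algebraType (G n))).

Lemma bmeas_filtration n m (f : T -> R) : (n <= m)%N -> bmeasG n f -> bmeasG m f.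
Proof.
move=> /subnK <-; elim: (m - n)%N => [//|k IH] /IH[mf bf].
split => // _ Y mY; move: (mf measurableT Y mY).
apply: sub_sigma_algebra2; exact: incrG.
Qed.

Context (a : nat -> R) (D : nat -> T -> R).
Hypothesis D_adapted : forall k, bmeasG k.+1 (D k).
Hypothesis D_bnd : forall k w, `|D k w| <= a k.
Hypothesis D_orth : forall k (g : T -> R), bmeasG k g -> E (fun w => g w * D k w) = 0.

(** Differences of the martingale whose steps are [D]. The hypothesis [D_orth] states that [D k] is
    conditionally centered given [G k], by testing against bounded [G k]-measurable weights instead
    of using conditional expectations. *)
Definition increment n m w := \sum_(n <= i < m) D i w.

Lemma increment_adapted n m : bmeasG m (increment n m).
Proof.
elim: m => [|m IH].
  rewrite /increment (_ : (fun w => _) = fun=> 0); first exact: bmeas_cst.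
  by apply/funext => w; rewrite big_geq.
have [mn|mn] := ltnP m n.
  rewrite /increment (_ : (fun w => _) = fun=> 0); first exact: bmeas_cst.
  by apply/funext => w; rewrite big_geq.
rewrite /increment (_ : (fun w => _) = fun w => increment n m w + D m w).
  by apply: bmeasD => //; exact: (bmeas_filtration _ IH).
by apply/funext => w; rewrite big_nat_recr.
Qed.

Lemma incrementS n m w : (n <= m)%N -> increment n m.+1 w = increment n m w + D m w.
Proof. by move=> nm; rewrite /increment big_nat_recr. Qed.

Lemma E_increment n m (g : T -> R) : bmeasG n g -> (n <= m)%N ->
  E (fun w => g w * increment n m w) = 0.
Proof.
move=> bg /subnK <-; elim: (m - n)%N => [|k IH].
  rewrite (_ : (fun w => _) = fun=> 0); first by rewrite Ecst.
  by apply/funext => w; rewrite /increment big_geq ?mulr0.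
have nk : (n <= k + n)%N by exact: leq_addl.
rewrite addSn (_ : (fun w => _) = fun w => g w * increment n (k + n) w + g w * D (k + n) w).
  have b1 := bmeas_sub (@mG _) bg; have b2 := bmeas_sub (@mG _) (increment_adapted n (k + n)).
  have b3 := bmeas_sub (@mG _) (D_adapted (k + n)).
  rewrite ED; [|by bm|by bm].
  rewrite IH add0r; exact: (D_orth (bmeas_filtration _ bg)).
by apply/funext => w; rewrite incrementS// mulrDr.
Qed.

(** Each cross term is a step times a bounded weight measurable before that step, so it vanishes by
    [D_orth]. *)
Lemma E_increment_sqr n m (g : T -> R) : bmeasG n g -> (n <= m)%N ->
  E (fun w => g w * increment n m w ^+ 2) =
  \sum_(n <= i < m) E (fun w => g w * D i w ^+ 2).
Proof.
move=> bg /subnK <-; elim: (m - n)%N => [|k IH].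
  rewrite big_geq// (_ : (fun w => _) = fun=> 0); first by rewrite Ecst.
  by apply/funext => w; rewrite /increment big_geq ?expr0n ?mulr0.
have nk : (n <= k + n)%N by exact: leq_addl.
rewrite addSn big_nat_recr//= -IH.
set Y := increment n (k + n).
rewrite (_ : (fun w => _) = fun w => g w * Y w ^+ 2 + g w * D (k + n) w ^+ 2
   + 2 * (g w * Y w * D (k + n) w)).
  have b1 := bmeas_sub (@mG _) bg; have b2 := bmeas_sub (@mG _) (increment_adapted n (k + n)).
  have b3 := bmeas_sub (@mG _) (D_adapted (k + n)).
  rewrite !ED ?EZ; try by rewrite /Y; bm.
  rewrite (_ : E (fun w => g w * Y w * _) = 0) ?mulr0 ?addr0//; apply: D_orth.
  apply: bmeasM; [exact: bmeas_filtration bg|exact: increment_adapted].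
by apply/funext => w; rewrite incrementS// -/Y; ring.
Qed.

Lemma E_increment_sqr_le n m (g : T -> R) : bmeasG n g -> (forall w, 0 <= g w) -> (n <= m)%N ->
  E (fun w => g w * increment n m w ^+ 2) <= (\sum_(n <= i < m) a i ^+ 2) * E g.
Proof.
move=> bg g0 nm; rewrite E_increment_sqr// mulr_suml; apply: ler_sum => i _.
have b1 := bmeas_sub (@mG _) bg; have b3 := bmeas_sub (@mG _) (D_adapted i).
rewrite -EZ//; apply: E_le; [by bm|by bm|] => w.
rewrite mulrC ler_wpM2r// -real_normK ?num_real//.
by rewrite lerXn2r ?nnegrE// (le_trans _ (D_bnd i w)).
Qed.

(** Induction on the number of steps. With [A] the sum so far and [c] the new squared bound, a step
    adds at most [(8 A c + 3 c^2) E g], and the right-hand side grows by [11 (2 A c + c^2) E g]. *)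
Lemma E_increment_exp4_le n m (g : T -> R) : bmeasG n g -> (forall w, 0 <= g w) -> (n <= m)%N ->
  E (fun w => g w * increment n m w ^+ 4) <=
  11 * (\sum_(n <= i < m) a i ^+ 2) ^+ 2 * E g.
Proof.
move=> bg g0 /subnK <-; elim: (m - n)%N => [|k IH].
  rewrite big_geq// (_ : (fun w => _) = fun=> 0).
    by rewrite Ecst expr0n mulr0 mul0r.
  by apply/funext => w; rewrite /increment big_geq ?expr0n ?mulr0.
have nk : (n <= k + n)%N by exact: leq_addl.
rewrite addSn big_nat_recr//=.
have := E_increment_sqr_le bg g0 nk; move: IH.
set A := \sum_(_ <= _ < _) _; set Y := increment n (k + n); set b := a (k + n)%N.
move=> IH4 IH2.
have b1 := bmeas_sub (@mG _) bg; have b2 := bmeas_sub (@mG _) (increment_adapted n (k + n)).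
have b3 := bmeas_sub (@mG _) (D_adapted (k + n)).
have bD w : D (k + n) w ^+ 2 <= b ^+ 2.
  rewrite -real_normK ?num_real//.
  by rewrite lerXn2r ?nnegrE// (le_trans _ (D_bnd (k + n) w)).
have b0 : 0 <= b ^+ 2 by exact: sqr_ge0.
have Eg0 : 0 <= E g by exact: E_ge0.
have A0 : 0 <= A by apply: sumr_ge0 => i _; exact: sqr_ge0.
(* In the expansion of [(y + x)^4], the bound [4 y x^3 <= 2 x^2 (x^2 + y^2)] leaves
   [8 x^2 y^2 + 3 x^4] besides [y^4] and [4 y^3 x]. The latter is kept exact because its expectation
   is 0. *)
apply: (@le_trans _ _ (E (fun w => g w * Y w ^+ 4 + 4 * (g w * Y w ^+ 3 * D (k + n) w)
   + 8 * b ^+ 2 * (g w * Y w ^+ 2) + 3 * b ^+ 4 * g w))).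
  have b4 := bmeas_sub (@mG _) (increment_adapted n (k + n).+1).
  apply: E_le; [by bm|by rewrite /Y; bm|] => w.
  rewrite incrementS// -/Y.
  have := bD w; have := g0 w; move: (g w) (Y w) (D (k + n) w) => u y x gw xb.
  have y2 : 0 <= y ^+ 2 by exact: sqr_ge0.
  have x2 : 0 <= x ^+ 2 by exact: sqr_ge0.
  have -> : b ^+ 4 = b ^+ 2 * b ^+ 2 by rewrite -exprD.
  rewrite -subr_ge0.
  have -> : u * y ^+ 4 + 4 * (u * y ^+ 3 * x) + 8 * b ^+ 2 * (u * y ^+ 2) +
     3 * (b ^+ 2 * b ^+ 2) * u - u * (y + x) ^+ 4 =
     u * (8 * y ^+ 2 * (b ^+ 2 - x ^+ 2) + 2 * x ^+ 2 * (y - x) ^+ 2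
       + 3 * ((b ^+ 2 - x ^+ 2) * (b ^+ 2 + x ^+ 2))) by ring.
  have h0 : 0 <= b ^+ 2 - x ^+ 2 by rewrite subr_ge0.
  have p1 : 0 <= 8 * y ^+ 2 * (b ^+ 2 - x ^+ 2).
    by apply: mulr_ge0 => //; exact: mulr_ge0.
  have p2 : 0 <= 2 * x ^+ 2 * (y - x) ^+ 2 by apply: mulr_ge0; [exact: mulr_ge0|exact: sqr_ge0].
  have p3 : 0 <= 3 * ((b ^+ 2 - x ^+ 2) * (b ^+ 2 + x ^+ 2)).
    by apply: mulr_ge0 => //; apply: mulr_ge0 => //; exact: addr_ge0.
  by apply: mulr_ge0 => //; apply: addr_ge0 => //; exact: addr_ge0.
rewrite !ED; try by rewrite /Y; bm.
rewrite !EZ; try by rewrite /Y; bm.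
have -> : E (fun w => g w * Y w ^+ 3 * D (k + n) w) = 0.
  by apply: D_orth; apply: bmeasM; [exact: bmeas_filtration bg|apply: bmeasX; exact: increment_adapted].
have -> : b ^+ 4 = b ^+ 2 * b ^+ 2 by rewrite -exprD.
rewrite mulr0 addr0; move: (b ^+ 2) b0 => c c0.
have h1 : 8 * c * E (fun w => g w * Y w ^+ 2) <= 8 * c * (A * E g).
  by rewrite ler_wpM2l// mulr_ge0.
have h2 : 0 <= A * c * E g by rewrite !mulr_ge0.
have h3 : 0 <= c * c * E g by rewrite !mulr_ge0.
move: IH4 h1; move: (E _) (E _) (E g) Eg0 h2 h3 => e4 e2 eg *.
nra.
Qed.

(** The fourth moment of the average is at most [11 / n^2], which is summable; second moments would
    only give the order [1 / n]. *)
Lemma martingale_lln : (forall k, a k = 1) ->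
  {ae P, forall w, n%:R^-1 * increment 0 n w @[n --> \oo] --> 0}.
Proof.
move=> a1.
pose f n w := (n%:R^-1 * increment 0 n w) ^+ 4.
have bI n : bmeas (increment 0 n) := bmeas_sub (@mG n) (increment_adapted 0 n).
have b1 : bmeasG 0 (fun=> 1 : R) by exact: bmeas_cst.
have : {ae P, forall w, f n w @[n --> \oo] --> 0}.
  apply: (@ae_cvg0_summable _ _ _ _ _ (fun n => 11 * (n%:R^-1) ^+ 2)).
  - by move=> n; have := bI n => ?; rewrite /f; bm.
  - by move=> n w; rewrite /f (_ : 4 = 2 * 2)%N// exprM sqr_ge0.
  - move=> n.
    rewrite (_ : f n = fun w => n%:R^-1 ^+ 4 * (1 * increment 0 n w ^+ 4)); last first.
      by apply/funext => w; rewrite /f exprMn mul1r.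
    rewrite EZ; last by have := bI n => ?; bm.
    have := E_increment_exp4_le b1 (fun=> ler01) (leq0n n).
    rewrite Ecst mulr1.
    have -> : \sum_(0 <= i < n) a i ^+ 2 = n%:R.
      under eq_bigr do rewrite a1 expr1n.
      by rewrite big_mkord sumr_const card_ord.
    have n40 : 0 <= n%:R^-1 ^+ 4 :> R by rewrite exprn_ge0// invr_ge0.
    move=> /(ler_wpM2l n40) /le_trans; apply.
    (* At [n = 0] the inverse is 0 by convention, so both sides vanish. *)
    case: n n40 => [_|n _]; first by rewrite invr0 !expr0n !mul0r mulr0.
    rewrite le_eqVlt; apply/orP; left; apply/eqP.
    have n0 : n.+1%:R != 0 :> R by rewrite pnatr_eq0.
    by field.
  - rewrite (_ : (fun n => _) = (fun n => 11 *: (n%:R^-1) ^+ 2)); last by [].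
    rewrite -/(11 *: _).
    apply: is_cvg_seriesZ.
    (* The series of [1 / n^2] is the case where limit and exponent both equal 1. *)
    apply: (@cvg_series_sqr _ _ 1 1); first by rewrite invf_lt1// ltr1n.
    apply/cvgrPdist_le => e e0; exists 1%N => // n /= n1.
    by rewrite powRr1// divff ?subrr ?normr0 ?ltW// pnatr_eq0 -lt0n.
apply: filterS => w; rewrite /f => cv.
apply/cvgrPdist_lt => e e0.
move/cvgrPdist_lt : cv => /(_ (e ^+ 4) (exprn_gt0 _ e0)).
apply: filterS => n; rewrite !sub0r !normrN normrX.
by rewrite ltr_pXn2r ?nnegrE ?(ltW e0).
Qed.

End martingale_differences.

(** * Conditional probabilities tested against bounded weights *)

Section conditional_probability.
Context (R : realType) (d : measure_display) (T : measurableType d).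
Context (P : probability T R) (G : set (set T)).
Hypothesis mG : G `<=` measurable.
Local Notation E f := (Rintegral P setT f).
Local Notation bmeasG := (@bmeas R _ (g_sigma_algebraType G)).

(** The defining identity says that [\1_A - f] is orthogonal to the indicators of the sigma-algebra;
    [E_orthogonal] extends this to all bounded measurable weights. *)
Lemma E_cond_prob (A : set T) (f : T -> R) : measurable A -> bmeas f ->
  is_cond_prob P <<s G >> A f ->
  forall g : T -> R, bmeasG g -> E (fun w => g w * \1_A w) = E (fun w => g w * f w).
Proof.
move=> mA bf [_ _ AB] g bg.
have bA : bmeas (\1_A : T -> R) by exact: bmeas_indic.
have bg' := bmeas_sub mG bg.
apply/eqP; rewrite -subr_eq0 -EB; [|by bm|by bm].
under eq_Rintegral do rewrite -mulrBr.
apply/eqP; apply: (@E_orthogonal _ _ _ P G mG) => //; first by bm.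
move=> B GB; have mB := sub_sigma_measurable mG GB.
have bB : bmeas (\1_B : T -> R) by exact: bmeas_indic.
under eq_Rintegral do rewrite mulrBr.
rewrite EB; [|by bm|by bm].
apply/eqP; rewrite subr_eq0; apply/eqP.
apply: EFin_inj.
rewrite (_ : (fun w => \1_B w * \1_A w) = \1_(A `&` B)); last first.
  by apply/funext => w; rewrite indicI/= mulrC.
rewrite E_indic; last exact: measurableI.
rewrite -AB// /Rintegral.
rewrite [in LHS]integral_mkcond.
rewrite fineK; last by apply: integrable_fin_num => //; apply: bmeas_integrable; bm.
apply: eq_integral => w _.
by rewrite patchE indicE; case: ifP => _ /=; rewrite ?mul1r ?mul0r.
Qed.

End conditional_probability.

(** * The model: filtration, ranges and adaptedness *)

Section model.
Context (R : realType) (d : measure_display) (T : measurableType d)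
  (P : probability T R) (N : nat) (W : 'M[R]_N).
Hypotheses (W_ge0 : forall h j : 'I_N, 0 <= W h j)
  (W_col : forall j : 'I_N, \sum_(h < N) W h j = 1).
Variable r : nat -> R.
Hypothesis r_bnd : forall n : nat, 0 <= r n < 1.
Variables (Z X : nat -> 'I_N -> {RV P >-> R}).
Hypotheses (Z0_bnd : forall (h : 'I_N) (w : T), 0 <= Z 0%N h w <= 1)
  (X_01 : forall (n : nat) (j : 'I_N) (w : T),
     X n.+1 j w = 0 \/ X n.+1 j w = 1)
  (Z_rec : forall (n : nat) (h : 'I_N) (w : T),
     Z n.+1 h w = (1 - r n) * Z n h w + r n * X n.+1 h w)
  (X_indep : forall n : nat,
     cond_independent P (history (fun h => Z 0%N h) (fun k j => X k j) n)
       (fun j => X n.+1 j))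
  (X_prob : forall (n : nat) (j : 'I_N),
     is_cond_prob P (history (fun h => Z 0%N h) (fun k j => X k j) n)
       [set w | X n.+1 j w = 1]
       (fun w => \sum_(h < N) W h j * Z n h w)).
Local Notation E f := (Rintegral P setT f).

(** The generators of [history], kept apart so that the sections above apply with
    [<<s history_gen n >>], which is [history] by unfolding. *)
Definition history_gen n : set (set T) :=
  [set A | exists h, preimage_set_system setT (Z 0%N h) measurable A] `|`
  [set A | exists k j, (1 <= k <= n)%N /\
                 preimage_set_system setT (X k j) measurable A].
Local Notation G := history_gen.
Local Notation bmeasG n := (@bmeas R _ (g_sigma_algebraType (G n))).

Definition success_prob n j w := \sum_(h < N) W h j * Z n h w.
Local Notation p := success_prob.

Lemma history_measurable n : G n `<=` measurable.
Proof.
move=> A [[h [B mB <-]]|[k [j [_ [B mB <-]]]]].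
- exact: (measurable_funPT (Z 0%N h)).
- exact: (measurable_funPT (X k j)).
Qed.

Lemma history_incr n : G n `<=` G n.+1.
Proof.
move=> A [?|[k [j [/andP[k1 kn] h]]]]; [by left|right].
by exists k, j; split => //; rewrite k1 leqW.
Qed.

Lemma X_ge0_le1 n j w : 0 <= X n.+1 j w <= 1.
Proof. by case: (X_01 n j w) => ->; rewrite lexx ler01. Qed.

Lemma Z_ge0_le1 n h w : 0 <= Z n h w <= 1.
Proof.
elim: n => [//|n /andP[Z0 Z1]]; rewrite Z_rec.
have /andP[r0 /ltW r1] := r_bnd n; have /andP[x0 x1] := X_ge0_le1 n h w.
apply/andP; split; first by rewrite addr_ge0// mulr_ge0// subr_ge0.
have : (1 - r n) * Z n h w <= (1 - r n) * 1 by rewrite ler_wpM2l// subr_ge0.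
have : r n * X n.+1 h w <= r n * 1 by rewrite ler_wpM2l.
lra.
Qed.

Lemma X_adapted n k j : (k < n)%N -> bmeasG n (X k.+1 j).
Proof.
move=> kn; split.
  move=> _ B mB; apply: sub_sigma_algebra; right.
  by exists k.+1, j; split => //; exists B.
exists 1 => w; rewrite ger0_norm; by have /andP[] := X_ge0_le1 k j w.
Qed.

Lemma Z_adapted n h : bmeasG n (Z n h).
Proof.
elim: n => [|n IH].
  split.
    move=> _ B mB; apply: sub_sigma_algebra; left.
    by exists h; exists B.
  by exists 1 => w; rewrite ger0_norm; have /andP[] := Z_ge0_le1 0 h w.
rewrite (_ : (Z n.+1 h : T -> R) = fun w => (1 - r n) * Z n h w + r n * X n.+1 h w).
  have bX := X_adapted h (ltnSn n).
  have bZ : bmeasG n.+1 (Z n h) := bmeas_filtration history_incr (leqnSn n) IH.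
  by bm.
by apply/funext => w; exact: Z_rec.
Qed.

Lemma p_adapted n j : bmeasG n (p n j).
Proof. by apply: bmeas_sum => h; have := Z_adapted n h; bm. Qed.

Lemma p_ge0_le1 n j w : 0 <= p n j w <= 1.
Proof.
apply/andP; split.
  by apply: sumr_ge0 => h _; rewrite mulr_ge0//; have /andP[] := Z_ge0_le1 n h w.
rewrite -(W_col j); apply: ler_sum => h _; rewrite -[leRHS]mulr1 ler_wpM2l//.
by have /andP[] := Z_ge0_le1 n h w.
Qed.

Let bZ n h : bmeas (Z n h) := bmeas_sub (@history_measurable n) (Z_adapted n h).
Let bX n j : bmeas (X n.+1 j) :=
  bmeas_sub (@history_measurable n.+1) (X_adapted j (ltnSn n)).
Let bp n j : bmeas (p n j) := bmeas_sub (@history_measurable n) (p_adapted n j).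

(** * Conditional moments of the noise *)

Let X_indic n j : \1_([set w | X n.+1 j w = 1]) = X n.+1 j :> (T -> R).
Proof.
apply/funext => w; rewrite indicE; case: (X_01 n j w) => Xw; rewrite Xw.
- by rewrite memNset//= Xw => /esym/eqP; rewrite oner_eq0.
- by rewrite mem_set.
Qed.

Let mX1 n j : measurable [set w | X n.+1 j w = 1].
Proof.
rewrite (_ : [set w | _] = [set: T] `&` X n.+1 j @^-1` [set 1]).
  exact: measurable_funPT.
by rewrite setTI.
Qed.

Lemma E_X n j (g : T -> R) : bmeasG n g ->
  E (fun w => g w * X n.+1 j w) = E (fun w => g w * p n j w).
Proof.
move=> bg; rewrite -X_indic.
exact: (E_cond_prob (@history_measurable n) (mX1 n j) (bp n j) (X_prob n j)).
Qed.

Lemma E_XX n i j (g : T -> R) : i != j -> bmeasG n g ->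
  E (fun w => g w * (X n.+1 i w * X n.+1 j w)) =
  E (fun w => g w * (p n i w * p n j w)).
Proof.
move=> ij bg.
(* Conditional independence is applied to the events that both variables equal 1, with the versions
   given by [X_prob]. *)
have := @X_indep n [set i; j]%SET (fun=> [set 1]) (fun j => p n j).
have m1 : measurable [set 1 : R] by [].
move=> /(_ (fun _ _ => m1) (fun j _ => X_prob n j)).
rewrite (_ : (\bigcap_(k in _) _) = [set w | X n.+1 i w = 1] `&` [set w | X n.+1 j w = 1]); last first.
  apply/seteqP; split => w /=.
    by move=> h; split; apply: h => /=; rewrite !inE eqxx ?orbT.
  by move=> [hi hj] k /=; rewrite !inE => /orP[]/eqP ->.
rewrite (_ : (fun w => \prod_(j in _) p n j w) = fun w => p n i w * p n j w); last first.
  by apply/funext => w; rewrite big_setU1 ?inE//= big_set1.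
have bpp : bmeas (fun w => p n i w * p n j w) by apply: bmeasM; exact: bp.
move=> /(E_cond_prob (@history_measurable n) (measurableI _ _ (mX1 n i) (mX1 n j)) bpp).
move=> /(_ g bg) <-; congr Rintegral; apply/funext => w.
by rewrite indicI/= !X_indic.
Qed.

Definition noise k j w := X k.+1 j w - p k j w.

Lemma noise_adapted k j : bmeasG k.+1 (noise k j).
Proof.
apply: bmeasB; first exact: X_adapted.
by apply: bmeas_filtration (p_adapted k j); [exact: history_incr|].
Qed.

Let bnoise k j : bmeas (noise k j) :=
  bmeas_sub (@history_measurable k.+1) (noise_adapted k j).

Lemma noise_bnd k j w : `|noise k j w| <= 1.
Proof.
rewrite ler_norml /noise.
have /andP[] := X_ge0_le1 k j w; have /andP[] := p_ge0_le1 k j w.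
by move=> *; apply/andP; split; lra.
Qed.

Lemma noise_orth k j (g : T -> R) : bmeasG k g ->
  E (fun w => g w * noise k j w) = 0.
Proof.
move=> bg; have bg' := bmeas_sub (@history_measurable k) bg.
under eq_Rintegral do rewrite mulrBr.
have ? := bX k j; have ? := bp k j.
by rewrite EB ?E_X ?subrr//; bm.
Qed.

(** Expanding the product gives [X_i X_j - p_i X_j - p_j (X_i - p_i)]: the first two terms both
    integrate to that of [p_i p_j], and the last is centered. *)
Lemma noise_cross k i j (g : T -> R) : i != j -> bmeasG k g ->
  E (fun w => g w * (noise k i w * noise k j w)) = 0.
Proof.
move=> ij bg; have bg' := bmeas_sub (@history_measurable k) bg.
have ? := bX k j; have ? := bp k j; have ? := bX k i; have ? := bp k i.
rewrite (_ : (fun w => _) = fun w => g w * (X k.+1 i w * X k.+1 j w) -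
  (g w * p k i w * X k.+1 j w + g w * p k j w * noise k i w)); last first.
  by apply/funext => w; rewrite /noise; ring.
have b1 : bmeasG k (fun w => g w * p k i w) by apply: bmeasM => //; exact: p_adapted.
have b2 : bmeasG k (fun w => g w * p k j w) by apply: bmeasM => //; exact: p_adapted.
have ? := bnoise k i.
rewrite EB; [|by bm|by bm].
rewrite ED; [|by bm|by bm].
rewrite E_XX// (noise_orth _ b2) (E_X _ b1) addr0.
under [X in _ - X]eq_Rintegral do rewrite -mulrA.
by rewrite subrr.
Qed.

(** For [x] in {0,1}, [(x - p)^2 = p (1 - p) + (1 - 2 p) (x - p)], and the last term is centered. *)
Lemma noise_sqr k j (g : T -> R) : bmeasG k g ->
  E (fun w => g w * (noise k j w * noise k j w)) =
  E (fun w => g w * (p k j w * (1 - p k j w))).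
Proof.
move=> bg; have bg' := bmeas_sub (@history_measurable k) bg.
have ? := bX k j; have ? := bp k j; have ? := bnoise k j.
rewrite (_ : (fun w => g w * (noise _ _ _ * _)) = fun w =>
  g w * (p k j w * (1 - p k j w)) + g w * (1 - 2 * p k j w) * noise k j w); last first.
  apply/funext => w; rewrite /noise.
  by case: (X_01 k j w) => ->; ring.
have b1 : bmeasG k (fun w => g w * (1 - 2 * p k j w)).
  by have ? := p_adapted k j; bm.
rewrite ED; [|by bm|by bm].
by rewrite (noise_orth _ b1) addr0.
Qed.

Lemma noise_lln j :
  {ae P, forall w, n%:R^-1 * \sum_(0 <= i < n) noise i j w @[n --> \oo] --> 0}.
Proof.
apply: (@martingale_lln _ _ _ P G history_measurable history_incr (fun=> 1)
  (fun k => noise k j)) => //.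
- by move=> k; exact: noise_adapted.
- by move=> k w; exact: noise_bnd.
- by move=> k g bg; exact: noise_orth.
Qed.

(** * The martingale of Perron averages *)

Variable v : 'I_N -> R.
Hypotheses (v_gt0 : forall j, 0 < v j) (v_sum : \sum_(j < N) v j = 1)
  (v_fix : forall h, \sum_(j < N) W h j * v j = v h).

Definition weighted n w := \sum_(j < N) v j * Z n j w.
Local Notation U := weighted.

Definition weighted_step k w := r k * \sum_(j < N) v j * noise k j w.
Local Notation dU := weighted_step.

(** The conditional variance of [\sum_j v j * noise k j]; the step itself carries the extra factor
    [r k ^+ 2]. *)
Definition cond_var k w := \sum_(j < N) v j ^+ 2 * (p k j w * (1 - p k j w)).
Local Notation q := cond_var.

(** Because [v] is a right eigenvector of [W], averaging the success probabilities returns the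
    average of the [Z n j]. This removes the drift and makes [U] a martingale. *)
Lemma weighted_success_prob n w : \sum_(j < N) v j * p n j w = U n w.
Proof.
rewrite /p /U; under eq_bigr do rewrite mulr_sumr.
rewrite exchange_big/=; apply: eq_bigr => h _.
rewrite -[in RHS]v_fix mulr_suml; apply: eq_bigr => j _.
by rewrite mulrCA mulrA.
Qed.

Lemma weightedS n w : U n.+1 w = U n w + dU n w.
Proof.
rewrite /dU /noise; under [\sum_(j < N) v j * (_ - _)]eq_bigr do rewrite mulrBr.
rewrite sumrB weighted_success_prob /U.
under eq_bigr do rewrite Z_rec mulrDr (mulrCA (v _)) (mulrCA (v _) (r _)).
by rewrite big_split/= -!mulr_sumr; ring.
Qed.

Lemma weighted_increment n m w : (n <= m)%N -> increment dU n m w = U m w - U n w.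
Proof.
move=> nm; rewrite /increment -(telescope_sumr (fun k => U k w))//.
by apply: eq_bigr => i _; rewrite weightedS addrAC subrr add0r.
Qed.

Lemma weighted_adapted n : bmeasG n (U n).
Proof. by apply: bmeas_sum => j; have ? := Z_adapted n j; bm. Qed.

Lemma weighted_ge0_le1 n w : 0 <= U n w <= 1.
Proof.
apply/andP; split.
  apply: sumr_ge0 => j _; rewrite mulr_ge0 ?(ltW (v_gt0 j))//.
  by have /andP[] := Z_ge0_le1 n j w.
rewrite -v_sum; apply: ler_sum => j _; rewrite -[leRHS]mulr1 ler_wpM2l ?(ltW (v_gt0 j))//.
by have /andP[] := Z_ge0_le1 n j w.
Qed.

Lemma step_adapted k : bmeasG k.+1 (dU k).
Proof.
apply: bmeasM; first exact: bmeas_cst.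
by apply: bmeas_sum => j; have ? := noise_adapted k j; bm.
Qed.

Lemma step_bnd k w : `|dU k w| <= r k.
Proof.
have /andP[r0 _] := r_bnd k.
rewrite normrM ger0_norm// -[leRHS]mulr1 ler_wpM2l//.
rewrite (le_trans (ler_norm_sum _ _ _))// -v_sum; apply: ler_sum => j _.
rewrite normrM gtr0_norm// -[leRHS]mulr1 ler_wpM2l ?(ltW (v_gt0 j))//.
exact: noise_bnd.
Qed.

Lemma step_orth k (g : T -> R) : bmeasG k g -> E (fun w => g w * dU k w) = 0.
Proof.
move=> bg; have bg' := bmeas_sub (@history_measurable k) bg.
have bn j := bnoise k j.
rewrite (_ : (fun w => _) = fun w => r k * \sum_(j < N) v j * (g w * noise k j w)).
  rewrite EZ; last by apply: bmeas_sum => j; have ? := bn j; bm.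
  rewrite E_sum; last by move=> j; have ? := bn j; bm.
  rewrite big1 ?mulr0// => j _; rewrite EZ; last by have ? := bn j; bm.
  by rewrite noise_orth ?mulr0.
apply/funext => w; rewrite /dU mulrCA mulr_sumr; congr (_ * _).
by apply: eq_bigr => j _; rewrite mulrCA.
Qed.

Lemma cond_var_adapted k : bmeasG k (q k).
Proof. by apply: bmeas_sum => j; have ? := p_adapted k j; bm. Qed.

(** In the double sum over pairs of coordinates, [noise_cross] kills the off-diagonal terms and
    [noise_sqr] evaluates the diagonal. *)
Lemma step_sqr k (g : T -> R) : bmeasG k g ->
  E (fun w => g w * dU k w ^+ 2) = r k ^+ 2 * E (fun w => g w * q k w).
Proof.
move=> bg; have bg' := bmeas_sub (@history_measurable k) bg.
have bn j := bnoise k j.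
have bpj j := bp k j.
have bb i j : bmeas (fun w => v i * v j * (g w * (noise k i w * noise k j w))).
  by have ? := bn i; have ? := bn j; bm.
rewrite (_ : (fun w => _) = fun w => r k ^+ 2 * \sum_(i < N) \sum_(j < N)
    v i * v j * (g w * (noise k i w * noise k j w))); last first.
  apply/funext => w; rewrite /dU exprMn mulrCA; congr (_ * _).
  rewrite expr2 mulr_suml mulr_sumr; apply: eq_bigr => i _.
  rewrite mulr_sumr mulr_sumr; apply: eq_bigr => j _; ring.
rewrite (_ : (fun w => g w * q k w) = fun w => \sum_(i < N)
    v i ^+ 2 * (g w * (p k i w * (1 - p k i w)))); last first.
  apply/funext => w; rewrite /q mulr_sumr; apply: eq_bigr => i _; ring.
rewrite EZ; last by apply: bmeas_sum => i; apply: bmeas_sum => j.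
rewrite !E_sum; first last.
- by move=> i; apply: bmeas_sum => j.
- by move=> i; have ? := bpj i; bm.
congr (_ * _); apply: eq_bigr => i _.
rewrite E_sum// (bigD1 i)//= big1 ?addr0.
  rewrite !EZ ?noise_sqr ?expr2//; first by have ? := bpj i; bm.
  by have ? := bn i; bm.
move=> j ji; rewrite EZ; last by have ? := bn i; have ? := bn j; bm.
by rewrite noise_cross ?mulr0// eq_sym.
Qed.

Lemma cond_var_ge0 k w : 0 <= q k w.
Proof.
apply: sumr_ge0 => j _; have /andP[p0 p1] := p_ge0_le1 k j w.
by rewrite mulr_ge0 ?sqr_ge0// mulr_ge0// subr_ge0.
Qed.

(** Each [v j * (1 - p k j)] is one nonnegative term of a sum equal to [1 - U k], while the
    [v j * p k j] add up to [U k]. *)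
Lemma cond_var_le k w : q k w <= U k w * (1 - U k w).
Proof.
rewrite -{1}weighted_success_prob mulr_suml; apply: ler_sum => j _.
have /andP[p0 p1] := p_ge0_le1 k j w.
rewrite (_ : _ * _ = v j * p k j w * (v j * (1 - p k j w))); last by ring.
rewrite ler_wpM2l ?mulr_ge0 ?(ltW (v_gt0 j))//.
rewrite -[X in _ <= X - _]v_sum -weighted_success_prob -sumrB (bigD1 j)//=.
rewrite mulrBr mulr1 lerDl; apply: sumr_ge0 => i _.
have /andP[_ ?] := p_ge0_le1 k i w.
by rewrite -[X in X - _]mulr1 -mulrBr mulr_ge0 ?(ltW (v_gt0 i))// subr_ge0.
Qed.


(** * Almost sure convergence of the empirical means *)

Variable Zinf : {RV P >-> R}.
Hypotheses (Zinf_bnd : forall w : T, 0 <= Zinf w <= 1)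
  (Zinf_lim : forall j : 'I_N,
     {ae P, forall w, Z n j w @[n --> \oo] --> Zinf w}).

Let bZinf : bmeas Zinf.
Proof.
by split=> //; exists 1 => w; rewrite ger0_norm; have /andP[] := Zinf_bnd w.
Qed.

Let bU n : bmeas (U n) := bmeas_sub (@history_measurable n) (weighted_adapted n).

Let bq n : bmeas (q n) := bmeas_sub (@history_measurable n) (cond_var_adapted n).

Let Z_cvg : {ae P, forall w, forall j, Z n j w @[n --> \oo] --> Zinf w}.
Proof. by apply: filter_forall => j; exact: Zinf_lim. Qed.

Let p_cvg w j : (forall i, Z n i w @[n --> \oo] --> Zinf w) ->
  p n j w @[n --> \oo] --> Zinf w.
Proof.
move=> Zw.
have -> : Zinf w = \sum_(h < N) W h j * Zinf w by rewrite -mulr_suml W_col mul1r.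
by apply: cvg_sumr => h; apply: cvgM; [exact: cvg_cst|exact: Zw].
Qed.

Let U_cvg w : (forall i, Z n i w @[n --> \oo] --> Zinf w) ->
  U n w @[n --> \oo] --> Zinf w.
Proof.
move=> Zw.
have -> : Zinf w = \sum_(h < N) v h * Zinf w by rewrite -mulr_suml v_sum mul1r.
by apply: cvg_sumr => h; apply: cvgM; [exact: cvg_cst|exact: Zw].
Qed.

Lemma empirical_mean_cvg : {ae P, forall w,
  empirical_mean (fun k j => X k j) n w @[n --> \oo]
    --> Zinf w *: (const_mx 1 : 'cV[R]_N)}.
Proof.
have lln : {ae P, forall w, forall j,
    n%:R^-1 * \sum_(0 <= i < n) noise i j w @[n --> \oo] --> 0}.
  by apply: filter_forall => j; exact: noise_lln.
apply: filterS2 lln Z_cvg => w lln Zw.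
have coord j : n%:R^-1 * (\sum_(1 <= k < n.+1) X k j w) @[n --> \oo] --> Zinf w.
  rewrite -[Zinf w]add0r.
  rewrite (_ : (fun n => _) = (fun n => n%:R^-1 * \sum_(0 <= i < n) noise i j w
      + n%:R^-1 * series (fun i => p i j w) n)); last first.
    apply/funext => n; rewrite -mulrDr -big_split/= big_add1/=.
    by congr (_ * _); apply: eq_bigr => i _; rewrite /noise subrK.
  apply: cvgD; first exact: lln.
  (* The Cesaro lemma averages the first [n+1] terms over [n+1], hence the shift. *)
  rewrite -cvg_shiftS; apply: (@cesaro _ (fun i => p i j w)); exact: p_cvg.
apply/cvg_ballP => e e0.
have near_ball : \forall n \near \oo, forall j,
    ball (Zinf w) e (n%:R^-1 * (\sum_(1 <= k < n.+1) X k j w)).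
  by apply: filter_forall => j; move/cvg_ballP: (coord j); apply.
apply: filterS near_ball => n near_ball; split => // i j.
by rewrite !mxE mulr1; exact: near_ball.
Qed.

(** * Decay of the expected [U (1 - U)] and nondegeneracy of the limit *)

Lemma E_weighted_quadratic n :
  E (fun w => U n.+1 w * (1 - U n.+1 w)) =
  E (fun w => U n w * (1 - U n w)) - r n ^+ 2 * E (q n).
Proof.
have ? := bU n; have ? := bmeas_sub (@history_measurable n.+1) (step_adapted n).
(* The linear term has a weight from the history and is centered; the factor 1 before the square
   provides the weight expected by [step_sqr]. *)
rewrite (_ : (fun w => U n.+1 w * _) = fun w => U n w * (1 - U n w) +
    ((1 - 2 * U n w) * dU n w - 1 * dU n w ^+ 2)); last first.
  by apply/funext => w; rewrite weightedS; ring.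
rewrite ED; [|by bm|by bm].
rewrite EB; [|by bm|by bm].
rewrite (@step_orth n (fun w => 1 - 2 * U n w)); last first.
  by have ? := weighted_adapted n; bm.
rewrite (@step_sqr n (fun=> 1)); last exact: bmeas_cst.
rewrite sub0r; congr (_ - _ * _).
by apply: eq_Rintegral => w _; rewrite mul1r.
Qed.

Hypothesis r_sqr : cvgn (series (fun n => r n ^+ 2)).

(** The sum of [r k ^+ 2] over [k >= n]; it is the scale of the variance of [Zinf - U n]. *)
Definition tail n := limn (series (fun n => r n ^+ 2)) - series (fun n => r n ^+ 2) n.

Lemma tail_cvg0 : tail n @[n --> \oo] --> 0.
Proof.
rewrite -[0](subrr (limn (series (fun n => r n ^+ 2)))).
by apply: cvgB => //; exact: cvg_cst.
Qed.

Lemma sum_cvg_tail n : \sum_(n <= k < m) r k ^+ 2 @[m --> \oo] --> tail n.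
Proof.
apply: cvg_trans; last by apply: (cvgB r_sqr); exact: cvg_cst.
by apply: near_eq_cvg; exists n => // m nm; exact: sub_series_geq.
Qed.

Lemma sum_le_tail n m : \sum_(n <= k < m) r k ^+ 2 <= tail n.
Proof.
apply: (cvgr_to_ge (@sum_cvg_tail n)); exists m => // k /= mk.
have [nm|mn] := leqP n m; last first.
  by rewrite (big_geq (ltnW mn)) sumr_ge0// => i _; exact: sqr_ge0.
by rewrite [leRHS](@big_cat_nat _ _ _ m)//= lerDl sumr_ge0// => i _; exact: sqr_ge0.
Qed.

Lemma E_quadratic_lim :
  E (fun w => U n w * (1 - U n w)) @[n --> \oo] --> E (fun w => Zinf w * (1 - Zinf w)).
Proof.
have bound (x : R) : 0 <= x <= 1 -> `|x * (1 - x)| <= 1.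
  move=> /andP[x0 x1]; rewrite normrM -[leRHS]mulr1 ler_pM//.
    by rewrite ger0_norm.
  by rewrite ger0_norm ?subr_ge0// gerBl.
apply: (@E_cvg _ _ _ _ _ _ 1).
- by move=> n; have ? := bU n; have [] // : bmeas (fun w => U n w * (1 - U n w)) by bm.
- by move=> n w; apply: bound; exact: weighted_ge0_le1.
- by have [] // : bmeas (fun w => Zinf w * (1 - Zinf w)) by bm.
- apply: filterS Z_cvg => w Zw; apply: cvgM; first exact: U_cvg.
  by apply: cvgB; [exact: cvg_cst|exact: U_cvg].
Qed.

(** Since [r n < 1], positivity survives each single step. To keep it in the limit, one starts at an
    [n0] whose tail is at most 1/2: all later losses together take at most half of [H n0]. *)
Lemma E_quadratic_gt0 : 0 < E (fun w => U 0%N w * (1 - U 0%N w)) ->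
  0 < E (fun w => Zinf w * (1 - Zinf w)).
Proof.
set H := fun n => E (fun w => U n w * (1 - U n w)); rewrite -/(H 0) => H0.
have Hq n : E (q n) <= H n.
  have ? := bU n; apply: E_le; [exact: bq|by bm|] => w; exact: cond_var_le.
have HS n : H n.+1 = H n - r n ^+ 2 * E (q n) by exact: E_weighted_quadratic.
have Eq0 n : 0 <= E (q n) by apply: E_ge0 => w; exact: cond_var_ge0.
have Hpos n : 0 < H n.
  elim: n => [//|n IH]; rewrite HS.
  apply: (@lt_le_trans _ _ ((1 - r n ^+ 2) * H n)).
    rewrite mulr_gt0// subr_gt0; have /andP[r0 r1] := r_bnd n.
    by rewrite expr_lt1.
  by rewrite mulrBl mul1r lerD2l lerN2 ler_wpM2l// sqr_ge0.
have Hdec n m : (n <= m)%N -> H m <= H n.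
  move=> /subnK <-; elim: (m - n)%N => [//|k IH]; rewrite addSn HS.
  by rewrite (le_trans _ IH)// gerBl mulr_ge0// sqr_ge0.
have [n0 _ tl] : \forall n \near \oo, tail n <= 2^-1.
  move: tail_cvg0 => /cvgr_le; apply.
  by rewrite invr_gt0.
have {}tl : tail n0 <= 2^-1 by apply: tl => /=.
(* Each later loss [r k ^+ 2 * E (q k)] is at most [r k ^+ 2 * H n0], as [H] is nonincreasing; so
   the losses add up. *)
have low m : H (m + n0)%N >= H n0 * (1 - \sum_(n0 <= k < m + n0) r k ^+ 2).
  elim: m => [|m IH]; first by rewrite add0n big_geq// subr0 mulr1.
  rewrite addSn HS big_nat_recr ?leq_addl//= opprD addrA mulrDr lerD//.
  rewrite mulrN lerN2 [leRHS]mulrC ler_wpM2l ?sqr_ge0//.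
  by rewrite (le_trans (Hq _))// Hdec// leq_addl.
apply: (@lt_le_trans _ _ (H n0 / 2)); first by rewrite divr_gt0.
apply: (cvgr_to_ge E_quadratic_lim); exists n0 => // m /= n0m.
rewrite -/(H m) -(subnK n0m) (le_trans _ (low _))// ler_wpM2l ?(ltW (Hpos _))//.
have := sum_le_tail n0 (m - n0 + n0); lra.
Qed.

(** A convex combination of points of [0,1] with positive weights is an endpoint only if every point
    is that endpoint. *)
Lemma quadratic_eq0 w : U 0%N w * (1 - U 0%N w) = 0 ->
  (forall j, Z 0%N j w = 0) \/ (forall j, Z 0%N j w = 1).
Proof.
have vp j := v_gt0 j.
move=> /eqP; rewrite mulf_eq0 => /orP[].
  rewrite /U psumr_eq0 => [/allP h|j _]; last first.
    by rewrite mulr_ge0 ?(ltW (vp j))//; have /andP[] := Z_ge0_le1 0 j w.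
  left => j; have := h j (mem_index_enum j).
  by rewrite /= mulf_eq0 (gt_eqF (vp j))/= => /eqP.
rewrite -[X in X - _]v_sum /U -sumrB psumr_eq0 => [/allP h|j _]; last first.
  rewrite -[X in X - _]mulr1 -mulrBr mulr_ge0 ?(ltW (vp j))// subr_ge0.
  by have /andP[] := Z_ge0_le1 0 j w.
right => j; have := h j (mem_index_enum j).
rewrite /= -[X in X - _]mulr1 -mulrBr mulf_eq0 (gt_eqF (vp j))/= subr_eq0.
by move=> /eqP <-.
Qed.

(** If the expectation of [U 0 * (1 - U 0)] were 0, almost every initial state would be all 0 or all
    1, against the hypothesis. So [Zinf * (1 - Zinf)], which is at most the indicator of
    [0 < Zinf < 1], has positive expectation. *)
Lemma Zinf_nondegenerate :
  (P (\bigcap_(j in [set: 'I_N]) [set w | (Z 0%N j w = 0)%R])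
    + P (\bigcap_(j in [set: 'I_N]) [set w | (Z 0%N j w = 1)%R]) < 1)%E ->
  (0 < P [set w | (0 < Zinf w < 1)%R])%E.
Proof.
set A0 := \bigcap_(j in _) _; set A1 := \bigcap_(j in _) _ => PA.
have mI (b : R) : measurable (\bigcap_(j in [set: 'I_N]) [set w | Z 0%N j w = b]).
  apply: fin_bigcap_measurable => // j _.
  rewrite (_ : [set w | _] = [set: T] `&` Z 0%N j @^-1` [set b]).
    exact: measurable_funPT.
  by rewrite setTI.
have mA0 : measurable A0 by exact: mI.
have mA1 : measurable A1 by exact: mI.
have bH : bmeas (fun w => U 0%N w * (1 - U 0%N w)) by have ? := bU 0; bm.
have H_ge0 w : 0 <= U 0%N w * (1 - U 0%N w).
  by have /andP[? ?] := weighted_ge0_le1 0 w; rewrite mulr_ge0// subr_ge0.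
have /E_quadratic_gt0 EZ0 : 0 < E (fun w => U 0%N w * (1 - U 0%N w)).
  rewrite lt0r E_ge0// andbT; apply/eqP => /(E_eq0 bH H_ge0) H0.
  move: PA; apply/negP; rewrite -leNgt.
  apply: (@le_trans _ _ (P (A0 `|` A1))).
    have -> : 1%E = P setT by rewrite probability_setT.
    rewrite -[leRHS]adde0 -H0.
    apply: le_trans (measureU2 _ _ _) => //; last exact: bmeas_neq0.
    + apply: le_measure; rewrite ?inE//.
        apply: measurableU; [exact: measurableU|exact: bmeas_neq0].
      move=> w _; have [h|h] := eqVneq (U 0%N w * (1 - U 0%N w)) 0; last by right.
      by left; have [a|a] := quadratic_eq0 h; [left|right] => j _; exact: a.
    + exact: measurableU.
  exact: measureU2.
rewrite lt0e measure_ge0 andbT; apply/eqP => P0.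
have mI01 : measurable [set w | 0 < Zinf w < 1].
  rewrite (_ : [set w | _] = [set: T] `&` Zinf @^-1` `]0, 1[).
    by apply: (measurable_funPT Zinf) => //; exact: measurable_itv.
  by rewrite setTI; apply/seteqP; split => w /=; rewrite in_itv.
have bI : bmeas (\1_[set w | 0 < Zinf w < 1] : T -> R) by exact: bmeas_indic.
have : E (fun w => Zinf w * (1 - Zinf w)) <= E (\1_[set w | 0 < Zinf w < 1]).
  apply: E_le => [|//|w]; first by bm.
  have /andP[z0 z1] := Zinf_bnd w; rewrite indicE.
  case: (boolP (_ \in _)) => [_|].
    rewrite -[leRHS]mulr1 ler_pM// ?subr_ge0//.
    by rewrite gerBl.
  rewrite notin_setE/= => /negP; rewrite negb_and -!leNgt => /orP[z|z].
    have -> : Zinf w = 0 by apply/eqP; rewrite eq_le z z0.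
    by rewrite mul0r.
  have -> : Zinf w = 1 by apply/eqP; rewrite eq_le z z1.
  by rewrite subrr mulr0.
rewrite leNgt (_ : E (\1__) = 0) ?EZ0//.
by apply: EFin_inj; rewrite E_indic.
Qed.

(** * Absence of atoms inside (0,1) *)

Hypothesis r_pos : \forall n \near \oo, 0 < r n.

Lemma tail_gt0 n : 0 < tail n.
Proof.
have [m _ rm] := r_pos.
apply: lt_le_trans (sum_le_tail n (maxn n m).+1).
rewrite big_nat_recr ?leq_maxl//=.
apply: ltr_wpDl; first by apply: sumr_ge0 => i _; exact: sqr_ge0.
by rewrite exprn_gt0// rm//= leq_maxr.
Qed.

Lemma E_increment_lim n (h : T -> R) k : bmeas h ->
  E (fun w => h w * (U m w - U n w) ^+ k) @[m --> \oo] -->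
  E (fun w => h w * (Zinf w - U n w) ^+ k).
Proof.
move=> bh; have [_ [M hM]] := bh; have ? := bU n.
apply: (@E_cvg _ _ _ _ _ _ M).
- move=> m; have ? := bU m.
  by have [] // : bmeas (fun w => h w * (U m w - U n w) ^+ k) by bm.
- move=> m w; rewrite normrM -[leRHS]mulr1 ler_pM// normrX.
  rewrite exprn_ile1//.
  have /andP[? ?] := weighted_ge0_le1 n w; have /andP[? ?] := weighted_ge0_le1 m w.
  by rewrite ler_norml; apply/andP; split; lra.
- by have [] // : bmeas (fun w => h w * (Zinf w - U n w) ^+ k) by bm.
- apply: filterS Z_cvg => w Zw; apply: cvgM; first exact: cvg_cst.
  by apply: cvg_exprn; apply: cvgB; [exact: U_cvg|exact: cvg_cst].
Qed.

(** * Weighted moments of the remainder [Zinf - U n] *)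

Section remainder.
Variables (n : nat) (g : T -> R).
Hypotheses (bg : bmeasG n g) (g01 : forall w, 0 <= g w <= 1).
Let g0 w : 0 <= g w. Proof. by have /andP[] := g01 w. Qed.
Let bg' := bmeas_sub (@history_measurable n) bg.

Let Eg1 : E g <= 1.
Proof.
rewrite -[leRHS](Ecst P); apply: E_le => // [|w]; first exact: bmeas_cst.
by have /andP[] := g01 w.
Qed.

Let incrE m k : (n <= m)%N ->
  E (fun w => g w * (U m w - U n w) ^+ k) = E (fun w => g w * increment dU n m w ^+ k).
Proof. by move=> nm; apply: eq_Rintegral => w _; rewrite weighted_increment. Qed.

Lemma E_remainder (s : T -> R) : bmeasG n s ->
  E (fun w => s w * (Zinf w - U n w)) = 0.
Proof.
move=> bs; have bs' := bmeas_sub (@history_measurable n) bs.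
have lim := @E_increment_lim n _ 1 bs'.
have : E (fun w => s w * (U m w - U n w) ^+ 1) @[m --> \oo] --> 0.
  apply: cvg_near_cst; exists n => // m /= nm.
  rewrite (_ : (fun w => _) = fun w => s w * increment dU n m w); last first.
    by apply/funext => w; rewrite weighted_increment// expr1.
  exact: (E_increment history_measurable history_incr step_adapted step_orth bs nm).
move=> /cvg_lim <- //; symmetry; apply: cvg_lim => //.
Qed.

Lemma E_remainder_sqr_le : E (fun w => g w * (Zinf w - U n w) ^+ 2) <= tail n.
Proof.
apply: (cvgr_to_le (E_increment_lim (n:=n) (k:=2) bg')); exists n => // m /= nm.
rewrite incrE//.
apply: le_trans (E_increment_sqr_le history_measurable history_incr step_adapted
  step_bnd step_orth bg g0 nm) _.
rewrite -[leRHS]mulr1 ler_pM ?E_ge0 ?sum_le_tail//.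
by apply: sumr_ge0 => i _; exact: sqr_ge0.
Qed.

Lemma E_remainder_exp4_le :
  E (fun w => g w * (Zinf w - U n w) ^+ 4) <= 11 * tail n ^+ 2.
Proof.
apply: (cvgr_to_le (E_increment_lim (n:=n) (k:=4) bg')); exists n => // m /= nm.
rewrite incrE//.
apply: le_trans (E_increment_exp4_le history_measurable history_incr step_adapted
  step_bnd step_orth bg g0 nm) _.
have s0 : 0 <= \sum_(n <= i < m) r i ^+ 2 by apply: sumr_ge0 => i _; exact: sqr_ge0.
rewrite -[leRHS]mulr1 ler_pM ?E_ge0 ?mulr_ge0 ?exprn_ge0//.
by rewrite ler_wpM2l// lerXn2r ?nnegrE ?(ltW (tail_gt0 n)) ?sum_le_tail.
Qed.

(** The weighted second moment is the limit of sums of [r k ^+ 2 * E (g q k)], in which every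
    expectation is at least [beta]. *)
Lemma E_remainder_sqr_ge (beta : R) :
  (forall k, (n <= k)%N -> beta <= E (fun w => g w * q k w)) ->
  beta * tail n <= E (fun w => g w * (Zinf w - U n w) ^+ 2).
Proof.
move=> qb.
have lim1 : beta * \sum_(n <= k < m) r k ^+ 2 @[m --> \oo] --> beta * tail n.
  by apply: cvgM; [exact: cvg_cst|exact: sum_cvg_tail].
apply: (ler_cvg_to lim1 (E_increment_lim (n:=n) (k:=2) bg')).
exists n => // m /= nm; rewrite incrE//.
rewrite (E_increment_sqr history_measurable history_incr step_adapted step_orth bg nm).
rewrite mulr_sumr big_nat [leRHS]big_nat; apply: ler_sum => k /andP[nk _].
rewrite step_sqr; last exact: (bmeas_filtration history_incr nk bg).
by rewrite mulrC ler_wpM2l ?sqr_ge0// qb.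
Qed.

End remainder.

(* Absurd for a good weight [g]: with [beta] fixed, first [a] is taken large,
   then [delta] small. *)
Lemma E_weight_bound n (g : T -> R) (z beta a delta : R) :
  bmeasG n g -> (forall w, 0 <= g w <= 1) ->
  0 < a -> 0 < delta ->
  E (fun w => `|g w - \1_[set w | Zinf w = z] w|) <= delta ^+ 2 ->
  (forall k, (n <= k)%N -> beta <= E (fun w => g w * q k w)) ->
  beta <= 2 * a * delta + 11 / a ^+ 2.
Proof.
set A := [set w | Zinf w = z] => bg g01 a0 d0 gA qb.
have g0 w : 0 <= g w by have /andP[] := g01 w.
have bg' := bmeas_sub (@history_measurable n) bg.
have bU' := bU n.
have mA : measurable A.
  rewrite (_ : A = [set: T] `&` Zinf @^-1` [set z]).
    exact: measurable_funPT.
  by rewrite setTI.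
have bA : bmeas (\1_A : T -> R) by exact: bmeas_indic.
pose Y w := Zinf w - U n w.
have bY : bmeas Y by rewrite /Y; bm.
pose rho := Num.sqrt (tail n).
have rho0 : 0 < rho by rewrite sqrtr_gt0 tail_gt0.
have rho2 : rho ^+ 2 = tail n by rewrite sqr_sqrtr// ltW// tail_gt0.
have Y2le : E (fun w => g w * Y w ^+ 2) <= tail n := E_remainder_sqr_le bg g01.
have Y4le : E (fun w => g w * Y w ^+ 4) <= 11 * tail n ^+ 2 :=
  E_remainder_exp4_le bg g01.
have Y2ge : beta * tail n <= E (fun w => g w * Y w ^+ 2) :=
  E_remainder_sqr_ge bg qb.
pose B : set T := [set w | z <= U n w].
have GB : <<s history_gen n >> B.
  rewrite (_ : B = [set: T] `&` U n @^-1` `[z, +oo[).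
    by have [mU _] := weighted_adapted n; apply: mU => //; exact: measurable_itv.
  by rewrite setTI; apply/seteqP; split => w /=; rewrite in_itv/= andbT.
(* The sign of [U n - z], measurable at time [n]. On [A] one has [Y = z - U n], so [|Y| + s Y]
   vanishes there; elsewhere it is at most [2 |Y|]. *)
pose s w := 2 * \1_B w - 1 : R.
have bB : bmeasG n (\1_B : T -> R) by apply: (@bmeas_indic R _ (g_sigma_algebraType (history_gen n))).
have bs : bmeasG n (fun w => g w * s w) by rewrite /s; bm.
have bs' := bmeas_sub (@history_measurable n) bs.
have sY : E (fun w => g w * s w * Y w) = 0 := E_remainder bs.
pose F w := g w * (1 - \1_A w) * `|Y w|.
have L1le : E (fun w => g w * `|Y w|) <= 2 * delta * rho.
  apply: (@le_trans _ _ (2 * E F)).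
    rewrite -[leLHS]addr0 -sY -ED; [|by bm|by bm].
    rewrite -EZ; last by rewrite /F; bm.
    apply: E_le; [by bm|by rewrite /F; bm|] => w; rewrite /F /s.
    have := g0 w; rewrite !indicE; case: (boolP (w \in A)) => [/set_mem/= Aw|_] gw.
      rewrite subrr mulr0 mul0r mulr0 -mulrA -mulrDr.
      have -> : Y w = z - U n w by rewrite /Y Aw.
      case: (boolP (w \in B)) => [/set_mem/=|/negP]/=.
        rewrite /B/= => Uz; rewrite ler0_norm ?subr_le0//.
        by rewrite (_ : _ + _ = 0) ?mulr0//; ring.
      rewrite inE /B/= => /negP; rewrite -ltNge => Uz.
      rewrite gtr0_norm ?subr_gt0//.
      by rewrite (_ : _ + _ = 0) ?mulr0//; ring.
    rewrite subr0 mulr1 -mulrA -mulrDr mulrCA ler_wpM2l//.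
    have := ler_norm (Y w); have := ler_norm (- Y w); rewrite normrN.
    by case: (w \in B) => /=; lra.
  suff : E F <= delta * rho by lra.
  (* This value balances the two terms of the AM-GM bound: [t rho^2] and [delta^2 / t] both equal
     [delta rho]. *)
  pose t := delta / rho.
  have t0 : 0 < t by rewrite divr_gt0.
  apply: (@le_trans _ _ (E (fun w => 2^-1 * (t * (g w * Y w ^+ 2) + t^-1 * `|g w - \1_A w|)))).
    apply: E_le; [by rewrite /F; bm|by bm|] => w; rewrite /F.
    (* AM-GM *)
    have amgm : `|Y w| <= 2^-1 * (t * Y w ^+ 2 + t^-1).
      rewrite -[Y w ^+ 2]real_normK ?num_real//.
      rewrite -subr_ge0 (_ : _ - _ = 2^-1 * t * (`|Y w| - t^-1) ^+ 2).
        by rewrite mulr_ge0 ?sqr_ge0// mulr_ge0// ltW.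
      by field; rewrite gt_eqF.
    have := g0 w; rewrite indicE; case: (_ \in _) => /= gw.
      rewrite subrr mulr0 mul0r; apply: mulr_ge0; first by rewrite invr_ge0.
      apply: addr_ge0; last by rewrite mulr_ge0 ?invr_ge0 ?(ltW t0).
      by rewrite mulr_ge0 ?(ltW t0)//; apply: mulr_ge0 => //; exact: sqr_ge0.
    rewrite !subr0 mulr1 (ger0_norm gw).
    rewrite (_ : 2^-1 * _ = g w * (2^-1 * (t * Y w ^+ 2 + t^-1))); last by ring.
    by rewrite ler_wpM2l.
  rewrite EZ; last by bm.
  rewrite ED; [|by bm|by bm].
  rewrite !EZ; [|by bm|by bm].
  have h1 : t * E (fun w => g w * Y w ^+ 2) <= t * rho ^+ 2.
    by rewrite ler_wpM2l ?(ltW t0)// rho2.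
  have h2 : t^-1 * E (fun w => `|g w - \1_A w|) <= t^-1 * delta ^+ 2.
    by rewrite ler_wpM2l ?invr_ge0 ?(ltW t0).
  have e1 : t * rho ^+ 2 = delta * rho by rewrite /t; field; rewrite gt_eqF.
  have e2 : t^-1 * delta ^+ 2 = delta * rho by rewrite /t; field; rewrite !gt_eqF.
  lra.
have arho : 0 < a * rho by rewrite mulr_gt0.
(* Splitting at the threshold [a rho]: below it [Y^2 <= a rho |Y|], above it
   [Y^2 <= Y^4 / (a rho)^2]. *)
have : E (fun w => g w * Y w ^+ 2) <=
    E (fun w => (a * rho) * (g w * `|Y w|) + (a * rho) ^- 2 * (g w * Y w ^+ 4)).
  apply: E_le; [by bm|by bm|] => w.
  rewrite [X in X + _]mulrCA [X in _ + X]mulrCA -mulrDr ler_wpM2l//.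
  have y0 : 0 <= `|Y w| by [].
  rewrite -[Y w ^+ 2]real_normK ?num_real// (_ : Y w ^+ 4 = `|Y w| ^+ 4); last first.
    by rewrite (_ : 4 = 2 * 2)%N// !exprM real_normK ?num_real.
  move: `|Y w| y0 => y y0.
  have [yl|/ltW yl] := leP y (a * rho).
    rewrite ler_wpDr ?mulr_ge0 ?invr_ge0 ?exprn_ge0 ?(ltW arho)//.
    by rewrite expr2 ler_wpM2r.
  apply: ler_wpDl; first by rewrite mulr_ge0 ?(ltW arho).
  rewrite [leRHS]mulrC ler_pdivlMr ?exprn_gt0//.
  have -> : y ^+ 4 = y ^+ 2 * y ^+ 2 by rewrite -exprD.
  by rewrite ler_wpM2l ?sqr_ge0// lerXn2r ?nnegrE ?(ltW arho).
rewrite ED; [|by bm|by bm].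
rewrite !EZ; [|by bm|by bm].
move=> h.
have h1 : a * rho * E (fun w => g w * `|Y w|) <= a * rho * (2 * delta * rho).
  by rewrite ler_wpM2l ?(ltW arho).
have h2 : (a * rho) ^- 2 * E (fun w => g w * Y w ^+ 4) <= (a * rho) ^- 2 * (11 * (rho ^+ 2) ^+ 2).
  by rewrite ler_wpM2l ?invr_ge0 ?exprn_ge0 ?(ltW arho)// rho2.
have e2 : (a * rho) ^- 2 * (11 * (rho ^+ 2) ^+ 2) = 11 / a ^+ 2 * rho ^+ 2.
  by field; rewrite !gt_eqF.
have e1 : a * rho * (2 * delta * rho) = 2 * a * delta * rho ^+ 2 by ring.
have r2 : 0 < rho ^+ 2 by rewrite exprn_gt0.
rewrite -(ler_pM2r r2) mulrDl -e1 -e2 [X in beta * X]rho2.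
by rewrite (le_trans Y2ge)// (le_trans h)// lerD.
Qed.

Lemma Zinf_atomless z : 0 < z < 1 -> P [set w | (Zinf w = z)%R] = 0%E.
Proof.
move=> /andP[z0 z1]; set A := [set w | Zinf w = z].
have mA : measurable A.
  rewrite (_ : A = [set: T] `&` Zinf @^-1` [set z]).
    exact: measurable_funPT.
  by rewrite setTI.
have bA : bmeas (\1_A : T -> R) by exact: bmeas_indic.
set alpha := E (\1_A).
have alpha_ge0 : 0 <= alpha by apply: E_ge0 => w; rewrite indicE.
rewrite -(E_indic P mA) -/alpha; congr EFin; apply/eqP/negPn/negP => alphaN0.
have alpha0 : 0 < alpha by rewrite lt0r alphaN0.
(* On [A] all [p k j] tend to [z], so [q k] tends to [sigma z (1 - z)]. *)
pose sigma := \sum_(j < N) v j ^+ 2.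
have sigma0 : 0 < sigma.
  rewrite lt0r sumr_ge0 ?andbT => [|j _]; last exact: sqr_ge0.
  apply/negP; rewrite psumr_eq0 => [/allP h|j _]; last exact: sqr_ge0.
  have := v_sum; rewrite big1 => [/esym/eqP|j _]; first by rewrite oner_eq0.
  by have /= := h j (mem_index_enum j); rewrite sqrf_eq0 => /eqP.
have Aq_lim : E (fun w => \1_A w * q k w) @[k --> \oo] --> sigma * z * (1 - z) * alpha.
  rewrite /alpha -EZ//.
  rewrite (_ : (fun w => _ * \1_A w) = fun w => \1_A w * (sigma * (Zinf w * (1 - Zinf w)))); last first.
    apply/funext => w; rewrite indicE; case: (boolP (w \in A)) => [/set_mem /= ->|_]; first by ring.
    by rewrite mulr0 mul0r.
  apply: (@E_cvg _ _ _ _ _ _ 1).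
  - by move=> k; have ? := bq k; have [] // : bmeas (fun w => \1_A w * q k w) by bm.
  - move=> k w; rewrite indicE normrM -[leRHS]mulr1 ler_pM//.
      by case: (_ \in _); rewrite ?normr1 ?normr0.
    rewrite ger0_norm ?cond_var_ge0// (le_trans (cond_var_le k w))//.
    have /andP[? ?] := weighted_ge0_le1 k w.
    by rewrite -[leRHS]mulr1 ler_pM// ?subr_ge0// gerBl.
  - by have [] // : bmeas (fun w => \1_A w * (sigma * (Zinf w * (1 - Zinf w)))) by bm.
  - apply: filterS Z_cvg => w Zw; apply: cvgM; first exact: cvg_cst.
    rewrite /sigma mulr_suml; apply: cvg_sumr => j; apply: cvgM; first exact: cvg_cst.
    by apply: cvgM; [|apply: cvgB; [exact: cvg_cst|]]; exact: p_cvg.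
(* A quarter of the limit of [E (\1_A q k)]. Eventually that expectation exceeds [2 beta], leaving
   room to replace the indicator by a smooth weight at cost [beta]. *)
pose beta := sigma * z * (1 - z) * alpha / 4.
have beta0 : 0 < beta by rewrite divr_gt0// !mulr_gt0// subr_gt0.
have Aq_near : \forall k \near \oo, 2 * beta <= E (fun w => \1_A w * q k w).
  move: Aq_lim => /cvgr_ge; apply.
  by rewrite (_ : sigma * z * (1 - z) * alpha = 4 * beta); [lra|rewrite /beta; field].
(* Together with [delta <= beta / (8 a)], this makes each term of the bound in [E_weight_bound] at
   most [beta / 4]. The other two constraints in [delta] give [delta ^+ 2 <= beta]. *)
pose a := 44 / beta + 1.
have a0 : 0 < a by rewrite addr_gt0// divr_gt0.
pose delta := Num.min 1 (Num.min beta (beta / (8 * a))).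
have d0 : 0 < delta by rewrite !lt_min ltr01 beta0 divr_gt0// mulr_gt0.
have [d1 d2 d3] : [/\ delta <= 1, delta <= beta & delta <= beta / (8 * a)].
  by rewrite /delta !ge_min !lexx ?orbT.
(* On [0,1] these polynomials take values in [0,1] and tend pointwise to the indicator of [z] as [K]
   grows. Being continuous in [x], they can be evaluated at [U n] in place of [Zinf]. *)
pose g K (x : R) := (1 - (x - z) ^+ 2) ^+ K.
have g01 K x : 0 <= x <= 1 -> 0 <= g K x <= 1.
  move=> /andP[x0 x1].
  have h0 : 0 <= (x - z) ^+ 2 by exact: sqr_ge0.
  have h1 : (x - z) ^+ 2 <= 1.
    by rewrite -real_normK ?num_real// exprn_ile1// ler_norml; apply/andP; split; lra.
  by rewrite /g exprn_ge0 ?exprn_ile1 ?subr_ge0// gerBl.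
have gA_bnd K x w : 0 <= x <= 1 -> `| `|g K x - \1_A w| | <= 1.
  move=> /(g01 K)/andP[? ?]; rewrite normr_id indicE ler_norml.
  by case: (_ \in _) => /=; apply/andP; split; lra.
have lim1 : E (fun w => `|g K (Zinf w) - \1_A w|) @[K --> \oo] --> 0.
  rewrite -(Ecst P 0); apply: (@E_cvg _ _ _ _ _ _ 1).
  - move=> K; have [] // : bmeas (fun w => `|g K (Zinf w) - \1_A w|) by rewrite /g; bm.
  - by move=> K w; exact: gA_bnd.
  - exact: measurable_cst.
  - apply: aeW => w; rewrite -[0](@normr0 _ R); apply: cvg_norm.
    rewrite indicE; case: (boolP (w \in A)) => [/set_mem /= Aw|].
      rewrite /g Aw subrr expr0n/= subr0.
      rewrite (_ : (fun K => _) = fun=> 0); first exact: cvg_cst.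
      by apply/funext => K; rewrite expr1n subrr.
    rewrite notin_setE/= => Aw; rewrite /g.
    rewrite (_ : (fun K => _) = fun K => (1 - (Zinf w - z) ^+ 2) ^+ K); last first.
      by apply/funext => K; rewrite subr0.
    apply: cvg_expr.
    have /andP[x0 x1] := Zinf_bnd w.
    have xz : 0 < (Zinf w - z) ^+ 2.
      by rewrite lt0r sqr_ge0 andbT sqrf_eq0 subr_eq0; apply/eqP.
    have h1 : (Zinf w - z) ^+ 2 <= 1.
      by rewrite -real_normK ?num_real// exprn_ile1// ler_norml; apply/andP; split; lra.
    by rewrite ger0_norm ?subr_ge0// gtrBl.
have d20 : 0 < delta ^+ 2 by rewrite exprn_gt0.
(* First [K] is fixed using [Zinf], then [n] is taken large for this [K]; the strict inequality
   leaves room for the second limit. *)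
have [K _ /(_ K (leqnn K)) /= gK] : \forall K \near \oo, E (fun w => `|g K (Zinf w) - \1_A w|) < delta ^+ 2.
  by move: lim1 => /cvgr_lt; apply.
have lim2 : E (fun w => `|g K (U n w) - \1_A w|) @[n --> \oo] -->
    E (fun w => `|g K (Zinf w) - \1_A w|).
  apply: (@E_cvg _ _ _ _ _ _ 1).
  - by move=> n; have ? := bU n; have [] // : bmeas (fun w => `|g K (U n w) - \1_A w|) by rewrite /g; bm.
  - by move=> n w; apply: gA_bnd; exact: weighted_ge0_le1.
  - by have [] // : bmeas (fun w => `|g K (Zinf w) - \1_A w|) by rewrite /g; bm.
  - apply: filterS Z_cvg => w Zw; apply: cvg_norm; apply: cvgB; last exact: cvg_cst.
    apply: cvg_exprn; apply: cvgB; first exact: cvg_cst.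
    by apply: cvg_exprn; apply: cvgB; [exact: U_cvg|exact: cvg_cst].
have [n1 _ gn1] : \forall n \near \oo, E (fun w => `|g K (U n w) - \1_A w|) <= delta ^+ 2.
  by move: lim2 => /cvgr_le; apply.
have [n2 _ Aqn2] := Aq_near.
pose n := maxn n1 n2.
have gn : E (fun w => `|g K (U n w) - \1_A w|) <= delta ^+ 2.
  by apply: gn1; rewrite /= leq_maxl.
have bU' := bU n.
have bg : bmeasG n (fun w => g K (U n w)).
  by rewrite /g; have ? := weighted_adapted n; bm.
(* As [0 <= q k <= 1], the exchange of [\1_A] for the weight costs at most [delta ^+ 2]. *)
have qb k : (n <= k)%N -> beta <= E (fun w => g K (U n w) * q k w).
  move=> nk; have ? := bq k.
  have Aqk : 2 * beta <= E (fun w => \1_A w * q k w).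
    by apply: Aqn2; rewrite /= (leq_trans _ nk)// leq_maxr.
  suff : E (fun w => \1_A w * q k w) <=
      E (fun w => g K (U n w) * q k w + `|g K (U n w) - \1_A w|).
    rewrite ED; [|by rewrite /g; bm|by rewrite /g; bm].
    have : delta ^+ 2 <= beta.
      by rewrite expr2 (le_trans _ d2)// -[leRHS]mulr1 ler_wpM2l// ltW.
    lra.
  apply: E_le; [by bm|by rewrite /g; bm|] => w.
  have q0 := cond_var_ge0 k w.
  have q1 : q k w <= 1.
    rewrite (le_trans (cond_var_le k w))//.
    have /andP[? ?] := weighted_ge0_le1 k w.
    by rewrite -[leRHS]mulr1 ler_pM// ?subr_ge0// gerBl.
  rewrite -lerBlDl -mulrBl (le_trans (ler_norm _))// normrM distrC (ger0_norm q0).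
  by rewrite -[leRHS]mulr1 ler_wpM2l.
have := E_weight_bound bg (fun w => g01 K _ (weighted_ge0_le1 n w)) a0 d0 gn qb.
apply/negP; rewrite -ltNge.
have h1 : 2 * a * delta <= beta / 4.
  apply: (@le_trans _ _ (2 * a * (beta / (8 * a)))).
    by rewrite ler_wpM2l// mulr_ge0// ltW.
  rewrite le_eqVlt; apply/orP; left; apply/eqP; field; rewrite gt_eqF//.
have h2 : 11 / a ^+ 2 <= beta / 4.
  rewrite ler_pdivrMr ?exprn_gt0//.
  apply: (@le_trans _ _ (beta / 4 * a)).
    rewrite /a mulrDr mulr1 (_ : beta / 4 * (44 / beta) = 11).
      by rewrite lerDl divr_ge0// ltW.
    by field; rewrite gt_eqF.
  apply: ler_wpM2l; first by rewrite divr_ge0// ltW.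
  rewrite expr2 -[leLHS]mulr1; apply: ler_wpM2l; first exact: ltW.
  by rewrite /a lerDr divr_ge0// ltW.
lra.
Qed.

End model.

Theorem theorem3p1 (R : realType) (d : measure_display) (T : measurableType d)
  (P : probability T R)
  (N : nat) (N_ge1 : (1 <= N)%N)
  (W : 'M[R]_N)
  (W_ge0 : forall h j : 'I_N, 0 <= W h j)
  (W_col : forall j : 'I_N, \sum_(h < N) W h j = 1)
  (W_irr : irreducible_mx W)
  (W_diag : diagonalizable_over_C W)
  (r : nat -> R) (c gamma : R)
  (r_bnd : forall n : nat, 0 <= r n < 1)
  (c_gt0 : 0 < c)
  (gamma_bnd : 2^-1 < gamma <= 1)
  (r_lim : ((n%:R `^ gamma) * r n) @[n --> \oo] --> c)
  (Z X : nat -> 'I_N -> {RV P >-> R})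
  (Z0_bnd : forall (h : 'I_N) (w : T), 0 <= Z 0%N h w <= 1)
  (X_01 : forall (n : nat) (j : 'I_N) (w : T),
     X n.+1 j w = 0 \/ X n.+1 j w = 1)
  (Z_rec : forall (n : nat) (h : 'I_N) (w : T),
     Z n.+1 h w = (1 - r n) * Z n h w + r n * X n.+1 h w)
  (X_indep : forall n : nat,
     cond_independent P (history (fun h => Z 0%N h) (fun k j => X k j) n)
       (fun j => X n.+1 j))
  (X_prob : forall (n : nat) (j : 'I_N),
     is_cond_prob P (history (fun h => Z 0%N h) (fun k j => X k j) n)
       [set w | X n.+1 j w = 1]
       (fun w => \sum_(h < N) W h j * Z n h w))
  (Zinf : {RV P >-> R})
  (Zinf_bnd : forall w : T, 0 <= Zinf w <= 1)
  (Zinf_lim : forall j : 'I_N,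
     {ae P, forall w, Z n j w @[n --> \oo] --> Zinf w}) :
  [/\ {ae P, forall w,
        empirical_mean (fun k j => X k j) n w @[n --> \oo]
          --> Zinf w *: (const_mx 1 : 'cV[R]_N)},
      (forall z : R, 0 < z < 1 -> P [set w | (Zinf w = z)%R] = 0%E)
    & ((P (\bigcap_(j in [set: 'I_N]) [set w | (Z 0%N j w = 0)%R])
        + P (\bigcap_(j in [set: 'I_N]) [set w | (Z 0%N j w = 1)%R]) < 1)%E ->
       (0 < P [set w | (0 < Zinf w < 1)%R])%E)].
Proof.
have /andP[gamma2 _] := gamma_bnd.
have r_sqr := cvg_series_sqr gamma2 r_lim.
(* Positivity of [c] makes the steps eventually positive, so that no tail of squared steps
   vanishes. *)
have r_pos : \forall n \near \oo, 0 < r n.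
  have : \forall n \near \oo, 0 < n%:R `^ gamma * r n by move: r_lim => /cvgr_gt; apply.
  apply: filterS => n h; have /andP[rn0 _] := r_bnd n.
  rewrite lt_neqAle rn0 andbT; apply/eqP => rn.
  by rewrite -rn mulr0 ltxx in h.
have [v [v0 v1 vW]] := perron_vector N_ge1 W_ge0 W_col W_irr.
split.
- exact: (empirical_mean_cvg W_ge0 W_col r_bnd Z0_bnd X_01 Z_rec X_prob Zinf_lim).
- exact: (Zinf_atomless W_ge0 W_col r_bnd Z0_bnd X_01 Z_rec X_indep X_prob v0 v1 vW
    Zinf_bnd Zinf_lim r_sqr r_pos).
- exact: (Zinf_nondegenerate W_ge0 W_col r_bnd Z0_bnd X_01 Z_rec X_indep X_prob v0 v1 vW
    Zinf_bnd Zinf_lim r_sqr).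
Qed.
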